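(* Consider the optimal control problem described in the context. Denote its optimal solution (control, terminal time, state, costate) by $(\hat u,\hat t_f,\hat x,\hat\lambda)$, and denote the approximate optimal solution obtained by the direct shooting method with a control parameterization $u(t)=u(t;p)$ by $(\tilde u(t;p),\tilde t_f,\tilde x,\tilde\lambda)$, where the costates $\hat\lambda,\tilde\lambda$ are the ones determined by the respective primary variables as in the context. If $\tilde u(t;p)\to\hat u$ and $\tilde t_f\to\hat t_f$, then the states and the costates converge: $\tilde x\to\hat x$ and $\tilde\lambda\to\hat\lambda$.
   Context: Optimal control problem: minimize $J=\varphi(x(t_f),t_f)+\int_{t_0}^{t_f}L(x(t),u(t),t)\,dt$ subject to $\dot x=f(x,u,t)$, $x(t_0)=x_0$, $g(x(t_f),t_f)=0$, where $x(t)\in\mathbb{R}^n$ has components in $C^2[t_0,t_f]$, $u(t)\in\mathbb{R}^m$ has components in $C^1[t_0,t_f]$, $t_0$ is fixed and $t_f$ is free. $L$ and its first-order partial derivatives are continuous; $\varphi$ and its first- and second-order partial derivatives are continuous; $f$ and its first-order partial derivatives are continuous and Lipschitz in $x,u,t$; $g:\mathbb{R}^n\times\mathbb{R}\to\mathbb{R}^q$ has continuous first-order partial derivatives. A solution of the problem is assumed to exist. Notation: given a control $u$, the state is $x(t)=x_0+\int_{t_0}^t f(x,u,s)\,ds$, and all quantities below are evaluated along $(x,u)$. Subscripts denote partial derivatives; gradients of scalars are column vectors; $g_{x_f}$ and $g_{t_f}$ are the partial derivatives of $g$ with respect to $x(t_f)$ and $t_f$. $\Phi_o(t,s)$ is the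 state transition matrix of the linearized dynamics: $\partial_t\Phi_o(t,s)=f_x(t)\Phi_o(t,s)$, $\Phi_o(s,s)=I$. Put $$p_u(t)=L_u+f_u^{T}(t)\Phi_o^{T}(t_f,t)\varphi_x(t_f)+f_u^{T}(t)\int_t^{t_f}\Phi_o^{T}(\sigma,t)L_x(\sigma)\,d\sigma .$$ $K$ is a positive-definite $m\times m$ matrix (possibly time-varying), $k_{t_f}>0$ a constant, $K_g$ a positive-definite $q\times q$ matrix. Optimal solution: it satisfies $g=0$, $p_u+f_u^T\Phi_o^T(t_f,t)g_{x_f}^T\pi=0$ on $[t_0,t_f]$, and $(\varphi_t+\varphi_x^Tf+L+\pi^T(g_{x_f}f+g_{t_f}))|_{t_f}=0$, with multiplier $\pi=\hat\pi=-M_\pi^{-1}r_\pi$, where $M_\pi=g_{x_f}\big(\int_{t_0}^{t_f}\Phi_o(t_f,t)f_uKf_u^T\Phi_o^T(t_f,t)dt\big)g_{x_f}^T+k_{t_f}(g_{x_f}f+g_{t_f})(g_{x_f}f+g_{t_f})^T|_{t_f}$ and $r_\pi=g_{x_f}\int_{t_0}^{t_f}\Phi_o(t_f,t)f_uKp_u\,dt+k_{t_f}(g_{x_f}f+g_{t_f})(\varphi_t+\varphi_x^Tf+L)|_{t_f}-K_gg$. Direct shooting approximate optimal solution: the control is parameterized as $u(t)=u(t;p)$, $p\in\mathbb{R}^s$, with Jacobian $u_p=\partial u/\partial p$ whose columns are linearly independent functions on $[t_0,t_f]$. Put $M_p=\int_{t_0}^{t_f}u_p^TK^{-1}u_p\,dt$,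 $r_{1p}=\int_{t_0}^{t_f}u_p^Tp_u\,dt$, $\Gamma_{1p}=\big(\int_{t_0}^{t_f}u_p^Tf_u^T\Phi_o^T(t_f,t)dt\big)g_{x_f}^T$, $M_{1\pi}=\Gamma_{1p}^TM_p^{-1}\Gamma_{1p}+k_{t_f}(g_{x_f}f+g_{t_f})(g_{x_f}f+g_{t_f})^T|_{t_f}$, $r_{1\pi}=\Gamma_{1p}^TM_p^{-1}r_{1p}+k_{t_f}(g_{x_f}f+g_{t_f})(\varphi_t+\varphi_x^Tf+L)|_{t_f}-K_gg$. It is assumed that the matrix obtained by stacking $\Gamma_{1p}$ on top of $(g_{x_f}f+g_{t_f})^T|_{t_f}$ has full column rank (so $M_{1\pi}$ is invertible). The approximate optimal solution satisfies $g=0$, $r_{1p}+\Gamma_{1p}\pi=0$ and $(\varphi_t+\varphi_x^Tf+L+\pi^T(g_{x_f}f+g_{t_f}))|_{t_f}=0$ with $\pi=\tilde\pi=-M_{1\pi}^{-1}r_{1\pi}$. Costate: for either solution, with its own $x,u,t_f,\pi$, $$\lambda(t)=\Phi_o^T(t_f,t)\big(\varphi_x(t_f)+g_{x_f}^T\pi\big)+\int_t^{t_f}\Phi_o^T(\sigma,t)L_x(\sigma)\,d\sigma .$$ The symbol ''$\to$'' means ''converges to''; for functions of time convergence is in the supremum norm (the Euclidean norm being used for vector values) on $[t_0,\max(\tilde t_f,\hat t_f)]$, the functions being continued to this common interval.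
   Formalization: Along the sequence of approximations the inverses of M_{1π} are assumed uniformly bounded, not merely to exist by the rank condition, since otherwise the costates need not converge; K and u_p are taken continuous in t so that the integrals exist. *)

(* Defs.v *)
(* World: MathComp + MathComp-Analysis, over an arbitrary [R : realType]. *)
From HB Require Import structures.
From mathcomp Require Import all_boot all_order all_algebra.
From mathcomp Require Import all_classical all_reals all_analysis.

Set Implicit Arguments.
Unset Strict Implicit.
Unset Printing Implicit Defensive.

Import Order.TTheory GRing.Theory Num.Theory.
Import numFieldNormedType.Exports.

Local Open Scope classical_set_scope.
Local Open Scope ring_scope.

Definition enorm (R : realType) (d : nat) (v : 'cV[R]_d) : R :=
  Num.sqrt (\sum_(i < d) v i 0 ^+ 2).

(* Extended-real valued, so that the supremum of an unbounded set is +oo and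
   not a default value. *)
Definition supdist (R : realType) (d : nat) (a b : R) (y z : R -> 'cV[R]_d)
    : \bar R :=
  ereal_sup [set (enorm (y t - z t))%:E | t in `[a, b]].

(* Oriented: [oint b a F = - oint a b F]. *)
Definition oint (R : realType) (a b : R) (F : R -> R) : R :=
  if a <= b then \int[lebesgue_measure]_(s in `[a, b]) F s
  else - \int[lebesgue_measure]_(s in `[b, a]) F s.

Definition mxint (R : realType) (d e : nat) (a b : R) (A : R -> 'M[R]_(d, e))
    : 'M[R]_(d, e) :=
  \matrix_(i < d, j < e) oint a b (fun s => A s i j).

Definition posdef (R : realType) (d : nat) (A : 'M[R]_d) : Prop :=
  A^T = A /\ forall v : 'cV[R]_d, v != 0 -> 0 < (v^T *m A *m v) 0 0.

(* [M k] invertible for every k does not prevent [M k] from becoming singular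
   in the limit; the bound on the inverses does. *)
Definition uniformly_invertible (R : realType) (d : nat) (M : nat -> 'M[R]_d)
    : Prop :=
  exists C : R, forall k, M k \in unitmx /\ `|invmx (M k)| <= C.

(* [dy] is the derivative of [y] on [a, b]; the derivative is two-sided inside
   and [y] is continuous up to the ends.  When [dy] is continuous on [a, b]
   this yields the one-sided derivatives [dy a] and [dy b] at the ends. *)
Definition deriv_on (R : realType) (V : normedModType R) (a b : R)
    (y dy : R -> V) : Prop :=
  {within `[a, b], continuous y} /\
  forall t, t \in `]a, b[ -> is_derive t (1 : R) y (dy t).

Definition C1_on (R : realType) (V : normedModType R) (a b : R)
    (y : R -> V) : Prop :=
  exists2 dy, deriv_on a b y dy & {within `[a, b], continuous dy}.

Definition C2_on (R : realType) (V : normedModType R) (a b : R)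
    (y : R -> V) : Prop :=
  exists2 dy, deriv_on a b y dy & C1_on a b dy.

Section Coordinates.
Context {R : realType} {n m : nat}.

Definition dirx (j : 'I_n) : 'cV[R]_n * 'cV[R]_m * R := (delta_mx j 0, 0, 0).
Definition diru (j : 'I_m) : 'cV[R]_n * 'cV[R]_m * R := (0, delta_mx j 0, 0).
Definition dirt : 'cV[R]_n * 'cV[R]_m * R := (0, 0, 1).

Definition dirs : set ('cV[R]_n * 'cV[R]_m * R) :=
  range dirx `|` range diru `|` [set dirt].

Definition dirxf (j : 'I_n) : 'cV[R]_n * R := (delta_mx j 0, 0).
Definition dirtf : 'cV[R]_n * R := (0, 1).

Definition dirsf : set ('cV[R]_n * R) := range dirxf `|` [set dirtf].

End Coordinates.

(* [D] is the set of coordinate directions, so that [C1 D F] says that [F] and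
   its first-order partial derivatives exist and are continuous. *)
Definition C1 (R : realType) (Z V : normedModType R) (D : set Z) (F : Z -> V)
    : Prop :=
  continuous F /\
  forall e, D e -> (forall z, derivable F z e) /\ continuous ('D_e F).

Definition C2 (R : realType) (Z V : normedModType R) (D : set Z) (F : Z -> V)
    : Prop :=
  C1 D F /\ forall e, D e -> C1 D ('D_e F).

Record ocp (R : realType) (n m q : nat) := OCP {
  t0 : R;
  x0 : 'cV[R]_n;
  phi : 'cV[R]_n * R -> R;
  Lag : 'cV[R]_n * 'cV[R]_m * R -> R;
  f : 'cV[R]_n * 'cV[R]_m * R -> 'cV[R]_n;
  g : 'cV[R]_n * R -> 'cV[R]_q }.

(* [lipschitz] is for the maximum norms, which changes only the constants. *)
Definition regular (R : realType) (n m q : nat) (P : ocp R n m q) : Prop :=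
  [/\ C1 dirs (Lag P),
      C2 dirsf (phi P),
      C1 dirs (f P) /\
        (lipschitz (f P) /\ forall e, dirs e -> lipschitz ('D_e (f P)))
    & C1 dirsf (g P)].

(* A control, its state, the terminal time, and the state transition matrix
   [Phi t s] of the dynamics linearized along them.  [tf] only marks the
   terminal time: the functions are also used past it, where they are
   continued. *)
Record traj (R : realType) (n m : nat) := Traj {
  ctl : R -> 'cV[R]_m;
  st : R -> 'cV[R]_n;
  tf : R;
  Phi : R -> R -> 'M[R]_n }.

Section Along.
Context {R : realType} {n m q : nat}.
Variables (P : ocp R n m q) (w : traj R n m).

Definition zt (t : R) : 'cV[R]_n * 'cV[R]_m * R := (st w t, ctl w t, t).
Definition zf : 'cV[R]_n * R := (st w (tf w), tf w).

Definition fx (t : R) : 'M[R]_n :=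
  \matrix_(i, j) ('D_(dirx j) (f P) (zt t)) i 0.
Definition fu (t : R) : 'M[R]_(n, m) :=
  \matrix_(i, j) ('D_(diru j) (f P) (zt t)) i 0.
Definition Lx (t : R) : 'cV[R]_n := \col_j 'D_(dirx j) (Lag P) (zt t).
Definition Lu (t : R) : 'cV[R]_m := \col_j 'D_(diru j) (Lag P) (zt t).
Definition phix : 'cV[R]_n := \col_j 'D_(dirxf j) (phi P) zf.
Definition phit : R := 'D_dirtf (phi P) zf.
Definition gx : 'M[R]_(q, n) := \matrix_(i, j) ('D_(dirxf j) (g P) zf) i 0.
Definition gt : 'cV[R]_q := 'D_dirtf (g P) zf.

Definition cost : R := phi P zf + oint (t0 P) (tf w) (fun t => Lag P (zt t)).

Definition feasible : Prop :=
  [/\ t0 P < tf w,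
      C1_on (t0 P) (tf w) (ctl w),
      C2_on (t0 P) (tf w) (st w),
      deriv_on (t0 P) (tf w) (st w) (fun t => f P (zt t)) /\
        st w (t0 P) = x0 P
    & g P zf = 0].

(* The continuation of a trajectory to [t0, T], [tf <= T], is by the formulas that
   define it: the control is continued continuously, the state is the one
   driven by the continued control, and [Phi] the corresponding transition
   matrix. *)
Definition continued (T : R) : Prop :=
  [/\ {within `[t0 P, T], continuous (ctl w)},
      {within `[t0 P, T], continuous (st w)},
      forall t, t \in `[t0 P, T] ->
        st w t = x0 P + mxint (t0 P) t (fun s => f P (zt s))
    & forall s, s \in `[t0 P, T] ->
        Phi w s s = 1%:M /\
        deriv_on (t0 P) T (fun t => Phi w t s) (fun t => fx t *m Phi w t s)].

(* g_{x_f} f + g_{t_f} and phi_t + phi_x^T f + L at the terminal time. *)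
Definition gdot : 'cV[R]_q := gx *m f P (zt (tf w)) + gt.
Definition hf : R :=
  phit + (phix^T *m f P (zt (tf w))) 0 0 + Lag P (zt (tf w)).

Definition pu (t : R) : 'cV[R]_m :=
  Lu t + (fu t)^T *m (Phi w (tf w) t)^T *m phix
  + (fu t)^T *m mxint t (tf w) (fun s => (Phi w s t)^T *m Lx s).

(* For [t > tf] the integral is oriented; this is the continuation of the
   costate past the terminal time. *)
Definition costate (pi : 'cV[R]_q) (t : R) : 'cV[R]_n :=
  (Phi w (tf w) t)^T *m (phix + gx^T *m pi)
  + mxint t (tf w) (fun s => (Phi w s t)^T *m Lx s).

Definition transversality (pi : 'cV[R]_q) : Prop :=
  hf + (pi^T *m gdot) 0 0 = 0.

Variables (K : R -> 'M[R]_m) (ktf : R) (Kg : 'M[R]_q).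

Definition Mpi : 'M[R]_q :=
  gx *m mxint (t0 P) (tf w) (fun t => Phi w (tf w) t *m fu t *m K t
                                        *m (fu t)^T *m (Phi w (tf w) t)^T)
     *m gx^T
  + ktf *: (gdot *m gdot^T).

Definition rpi : 'cV[R]_q :=
  gx *m mxint (t0 P) (tf w) (fun t => Phi w (tf w) t *m fu t *m K t *m pu t)
  + (ktf * hf) *: gdot - Kg *m g P zf.

(* [invmx] is only meaningful on invertible matrices, hence the clause
   [Mpi \in unitmx]. *)
Definition optimality (pi : 'cV[R]_q) : Prop :=
  [/\ g P zf = 0,
      forall t, t \in `[t0 P, tf w] ->
        pu t + (fu t)^T *m (Phi w (tf w) t)^T *m gx^T *m pi = 0,
      transversality pi,
      Mpi \in unitmx
    & pi = - (invmx Mpi *m rpi)].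

Variables (s : nat) (U : R -> 'cV[R]_s -> 'cV[R]_m) (p : 'cV[R]_s).

Definition up (t : R) : 'M[R]_(m, s) :=
  \matrix_(i, j) ('D_(delta_mx j 0) (U t) p) i 0.

Definition parameterized : Prop :=
  [/\ forall t, t \in `[t0 P, tf w] -> ctl w t = U t p,
      forall t j, t \in `[t0 P, tf w] -> derivable (U t) p (delta_mx j 0),
      {within `[t0 P, tf w], continuous up}
    & forall c : 'cV[R]_s,
        (forall t, t \in `[t0 P, tf w] -> up t *m c = 0) -> c = 0].

Definition Mp : 'M[R]_s :=
  mxint (t0 P) (tf w) (fun t => (up t)^T *m invmx (K t) *m up t).
Definition r1p : 'cV[R]_s :=
  mxint (t0 P) (tf w) (fun t => (up t)^T *m pu t).
Definition Gam1p : 'M[R]_(s, q) :=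
  mxint (t0 P) (tf w) (fun t => (up t)^T *m (fu t)^T *m (Phi w (tf w) t)^T)
  *m gx^T.

Definition M1pi : 'M[R]_q :=
  Gam1p^T *m invmx Mp *m Gam1p + ktf *: (gdot *m gdot^T).
Definition r1pi : 'cV[R]_q :=
  Gam1p^T *m invmx Mp *m r1p + (ktf * hf) *: gdot - Kg *m g P zf.

(* [row_full A] says that the rank of [A] is its number of columns. *)
Definition approx_optimality (pi : 'cV[R]_q) : Prop :=
  [/\ g P zf = 0,
      r1p + Gam1p *m pi = 0,
      transversality pi,
      row_full (col_mx Gam1p gdot^T)
    & pi = - (invmx M1pi *m r1pi)].

End Along.

Definition optimal (R : realType) (n m q : nat) (P : ocp R n m q)
    (w : traj R n m) : Prop :=
  feasible P w /\ forall w', feasible P w' -> cost P w <= cost P w'.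

(* Main.v *)
(* Uniform convergence of the controls and of the terminal times is propagated by
   Gronwall's inequality to the states and to the transition matrices of the
   linearized dynamics, hence to all the data evaluated along the trajectories and
   to the costates computed with a common multiplier [pihat].  What remains is
   [pitil --> pihat].  Let [e] be the value of the stationarity condition along the
   approximate solution, with the optimal multiplier: it tends to 0 uniformly.
   Writing [r = int u_p^T e] and [d = pitil - pihat], the necessary conditions give
   [Gamma d = - r], and [gdot^T d = - tau] with [tau --> 0], so that
   [d^T M_1pi d = r^T M_p^-1 r + k_tf tau^2].  Since [r^T M_p^-1 r] is the squared
   norm of an orthogonal projection of [K e] for the weight [K^-1], it is at most
   [int e^T K e --> 0], uniformly over the parameterizations; the bound on the
   inverses of [M_1pi] then gives [d --> 0]. *)
Require Import Defs.
From HB Require Import structures.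
From mathcomp Require Import all_boot all_order all_algebra.
From mathcomp Require Import all_classical all_reals all_analysis.
From mathcomp Require Import ring lra.

Set Implicit Arguments.
Unset Strict Implicit.
Unset Printing Implicit Defensive.

Import Order.TTheory GRing.Theory Num.Theory.
Import numFieldNormedType.Exports.

Local Open Scope classical_set_scope.
Local Open Scope ring_scope.

(** * Matrices: norm and limits *)

Section MatrixNorm.
Context {R : realType}.

Lemma mxnorm_entry d e (A : 'M[R]_(d, e)) i j : `|A i j| <= `|A|.
Proof.
rewrite {2}/Num.norm /= mx_normrE; apply/bigmax_geP; right => /=.
by exists (i, j).
Qed.

Lemma mxnorm_le d e (A : 'M[R]_(d, e)) (c : R) :
  0 <= c -> (forall i j, `|A i j| <= c) -> `|A| <= c.
Proof.
move=> c0 h; rewrite {1}/Num.norm /= mx_normrE; by apply/bigmax_leP; split.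
Qed.

Lemma mxnorm_mul d e k (A : 'M[R]_(d, e)) (B : 'M[R]_(e, k)) :
  `|A *m B| <= e%:R * `|A| * `|B|.
Proof.
apply: mxnorm_le => [|i j]; first by rewrite !mulr_ge0.
rewrite mxE; apply: le_trans (ler_norm_sum _ _ _) _.
apply: (@le_trans _ _ (\sum_(i < e) `|A| * `|B|)).
  by apply: ler_sum => l _; rewrite normrM ler_pM ?mxnorm_entry.
by rewrite sumr_const card_ord -mulrA mulr_natl.
Qed.

Lemma mxnorm_tr d e (A : 'M[R]_(d, e)) : `|A^T| = `|A|.
Proof.
apply/eqP; rewrite eq_le; apply/andP; split; apply: mxnorm_le => // i j.
  by rewrite mxE mxnorm_entry.
by have := mxnorm_entry A^T j i; rewrite mxE.
Qed.

Lemma mxnorm_enorm d (v : 'cV[R]_d) : `|v| <= enorm v.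
Proof.
apply: mxnorm_le => [|i j]; first exact: sqrtr_ge0.
rewrite /enorm -sqrtr_sqr ler_sqrt; last by apply: sumr_ge0 => *; exact: sqr_ge0.
rewrite (bigD1 i) //= (ord1 j) lerDl.
by apply: sumr_ge0 => *; exact: sqr_ge0.
Qed.

Lemma enorm_mxnorm d (v : 'cV[R]_d) : enorm v <= d%:R * `|v|.
Proof.
case: d v => [|d] v; first by rewrite /enorm big_ord0 sqrtr0 mul0r.
rewrite -[leRHS]ger0_norm ?mulr_ge0// -sqrtr_sqr ler_sqrt ?sqr_ge0//.
apply: (@le_trans _ _ (\sum_(i < d.+1) `|v| ^+ 2)).
  apply: ler_sum => i _; rewrite -real_normK ?num_real//.
  by rewrite lerXn2r ?nnegrE// mxnorm_entry.
rewrite sumr_const card_ord -[leLHS]mulr_natl exprMn. rewrite ler_wpM2r ?sqr_ge0//.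
by rewrite -natrX ler_nat expnS leq_pmulr.
Qed.

Lemma quad_le d (v : 'cV[R]_d) (A : 'M[R]_d) :
  `|(v^T *m A *m v) 0 0| <= d%:R ^+ 2 * `|A| * `|v| ^+ 2.
Proof.
apply: le_trans (mxnorm_entry _ _ _) _.
apply: le_trans (mxnorm_mul _ _) _.
rewrite (_ : _ * _ ^+ 2 = d%:R * (d%:R * `|v^T| * `|A|) * `|v|); last first.
  by rewrite mxnorm_tr; ring.
by rewrite ler_wpM2r // ler_wpM2l // mxnorm_mul.
Qed.

Lemma sqr_le_dot d (v : 'cV[R]_d) : `|v| ^+ 2 <= (v^T *m v) 0 0.
Proof.
rewrite mxE (_ : \sum_j _ = enorm v ^+ 2).
  by rewrite lerXn2r ?nnegrE ?sqrtr_ge0// mxnorm_enorm.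
rewrite sqr_sqrtr; last by apply: sumr_ge0 => *; exact: sqr_ge0.
by apply: eq_bigr => i _; rewrite !mxE expr2.
Qed.

End MatrixNorm.

Section MatrixLimits.
Context {R : realType}.

Lemma cvg_mxP {T : Type} {F : set_system T} {FF : Filter F} d e
    (y : T -> 'M[R]_(d, e)) (A : 'M[R]_(d, e)) :
  y @ F --> A <-> forall i j, (fun t => y t i j) @ F --> A i j.
Proof.
split=> [yA i j|h].
  apply: (cvg_comp _ (fun M : 'M[R]_(d, e) => M i j) yA).
  exact: coord_continuous.
apply/cvgrPdist_le => eps eps0.
have H : \forall t \near F, forall ij : 'I_d * 'I_e,
    `|A ij.1 ij.2 - y t ij.1 ij.2| <= eps.
  apply: filter_forall => ij.
  by have /cvgrPdist_le/(_ _ eps0) := h ij.1 ij.2.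
apply: filterS H => t h'; apply: mxnorm_le; first exact: ltW.
by move=> i j; rewrite !mxE; exact: (h' (i, j)).
Qed.

Lemma cvg_mulmx {T : Type} {F : set_system T} {FF : Filter F} d e k
    (y : T -> 'M[R]_(d, e)) (z : T -> 'M[R]_(e, k))
    (A : 'M[R]_(d, e)) (B : 'M[R]_(e, k)) :
  y @ F --> A -> z @ F --> B -> (fun t => y t *m z t) @ F --> A *m B.
Proof.
move=> /cvg_mxP yA /cvg_mxP zB; apply/cvg_mxP => i j.
rewrite mxE (_ : (fun _ => _) = fun t => \sum_l y t i l * z t l j); last first.
  by apply/funext => t; rewrite mxE.
by apply: cvg_big => [|l _]; [exact: add_continuous|exact: cvgM].
Qed.

Lemma cvg_trmx {T : Type} {F : set_system T} {FF : Filter F} d e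
    (y : T -> 'M[R]_(d, e)) (A : 'M[R]_(d, e)) :
  y @ F --> A -> (fun t => (y t)^T) @ F --> A^T.
Proof.
move=> /cvg_mxP yA; apply/cvg_mxP => i j.
rewrite mxE (_ : (fun _ => _) = fun t => y t j i); first exact: yA.
by apply/funext => t; rewrite mxE.
Qed.

Lemma cvg_det {T : Type} {F : set_system T} {FF : Filter F} d
    (y : T -> 'M[R]_d) (A : 'M[R]_d) :
  y @ F --> A -> (fun t => \det (y t)) @ F --> \det A.
Proof.
move=> /cvg_mxP yA; apply: cvg_big => [|s _]; first exact: add_continuous.
apply: cvgM; first exact: cvg_cst.
by apply: cvg_big => [|i _]; [exact: mul_continuous|exact: yA].
Qed.

Lemma cvg_invmx {T : Type} {F : set_system T} {FF : Filter F} d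
    (y : T -> 'M[R]_d) (A : 'M[R]_d) : A \in unitmx -> (forall t, y t \in unitmx) ->
  y @ F --> A -> (fun t => invmx (y t)) @ F --> invmx A.
Proof.
move=> uA uy yA.
rewrite (_ : (fun _ => _) = fun t => (\det (y t))^-1 *: \adj (y t)); last first.
  by apply/funext => t; rewrite /invmx uy.
rewrite /invmx uA; apply: cvgZ.
  by apply: cvgV; [rewrite -unitfE -unitmxE|exact: cvg_det].
apply/cvg_mxP => i j; rewrite mxE.
rewrite (_ : (fun _ => _) = fun t => cofactor (y t) j i); last first.
  by apply/funext => t; rewrite mxE.
apply: cvgM; first exact: cvg_cst.
apply: cvg_det; apply/cvg_mxP => k l.
rewrite !mxE (_ : (fun _ => _) = fun t => y t (lift j k) (lift i l)); last first.
  by apply/funext => t; rewrite !mxE.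
by move/cvg_mxP : yA; apply.
Qed.

Lemma is_derive_mxP d e (y : R -> 'M[R]_(d, e)) (dy : 'M[R]_(d, e)) t :
  is_derive t (1 : R) y dy <->
  forall i j, is_derive t (1 : R) (fun s => y s i j) (dy i j).
Proof.
have key i j :
    (fun h : R => h^-1 *: (((fun s => y s i j) \o shift t) (h *: (1 : R)) - y t i j))
    = (fun h : R => (h^-1 *: ((y \o shift t) (h *: (1 : R)) - y t)) i j).
  by apply/funext => h /=; rewrite !mxE.
split=> [[dr dE] i j|h].
  have : h^-1 *: ((y \o shift t) (h *: (1 : R)) - y t) @[h --> 0^'] --> dy.
    by rewrite -dE; exact: dr.
  move=> /cvg_mxP/(_ i j) H.
  have H' : (fun h : R => h^-1 *:
      (((fun s => y s i j) \o shift t) (h *: (1 : R)) - y t i j)) @ 0^' --> dy i j.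
    by rewrite key.
  by apply: DeriveDef; [apply/cvg_ex; exists (dy i j)|exact: cvg_lim H'].
have : h^-1 *: ((y \o shift t) (h *: (1 : R)) - y t) @[h --> 0^'] --> dy.
  apply/cvg_mxP => i j; have [dr dE] := h i j.
  by rewrite -key -dE; exact: dr.
move=> H; apply: DeriveDef; [apply/cvg_ex; exists dy => //|exact: cvg_lim H].
Qed.

End MatrixLimits.

(** * Gronwall's inequality *)

Section Segments.
Context {R : realType}.
Implicit Types a b s t : R.

Lemma within_subsegment (V : topologicalType) a b s t (y : R -> V) :
  a <= s -> t <= b -> {within `[a, b], continuous y} ->
  {within `[s, t], continuous y}.
Proof.
move=> as_ tb; apply: continuous_subspaceW => r /=.
rewrite !in_itv /= => /andP[sr rt].
by rewrite (le_trans as_ sr) (le_trans rt tb).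
Qed.

Lemma within_bounded (V : normedModType R) a b (y : R -> V) :
  {within `[a, b], continuous y} ->
  exists2 M : R, 0 <= M & forall t, t \in `[a, b] -> `|y t| <= M.
Proof.
move=> cy; have := compact_bounded (continuous_compact cy (@segment_compact R a b)).
move=> [M [_ /(_ (Num.max 0 M + 1)) h]].
exists (Num.max 0 M + 1); first by rewrite addr_ge0 // le_max lexx.
move=> t tab; apply: h; last by exists t.
by rewrite (@le_lt_trans _ _ (Num.max 0 M)) ?le_max ?lexx ?orbT// ltrDl.
Qed.

Lemma deriv_onB (V : normedModType R) a b (y dy z dz : R -> V) :
  deriv_on a b y dy -> deriv_on a b z dz ->
  deriv_on a b (fun t => y t - z t) (fun t => dy t - dz t).
Proof.
move=> [cy hy] [cz hz]; split; first exact: within_continuousB.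
by move=> t tab; apply: is_deriveB; [exact: hy|exact: hz].
Qed.

Lemma deriv_on_subsegment (V : normedModType R) a b s t (y dy : R -> V) :
  a <= s -> t <= b -> deriv_on a b y dy -> deriv_on s t y dy.
Proof.
move=> as_ tb [cy hy]; split; first exact: within_subsegment cy.
move=> r; rewrite in_itv /= => /andP[sr rt]; apply: hy.
by rewrite in_itv /= (le_lt_trans as_ sr) (lt_le_trans rt tb).
Qed.

Lemma deriv_on_ge0 a b (y dy : R -> R) : deriv_on a b y dy ->
  (forall t, t \in `]a, b[ -> 0 <= dy t) ->
  forall s t, s \in `[a, b] -> t \in `[a, b] -> s <= t -> y s <= y t.
Proof.
move=> [cy hy] dy0 s t; rewrite !in_itv /= => /andP[as_ sb] /andP[at_ tb] st.
apply: (@ger0_derive1_ndecr _ y a b) => // r rab; have [dr rE] := hy r rab => //.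
by rewrite derive1E rE dy0.
Qed.

Lemma deriv_on_lip a b (y dy : R -> R) M : deriv_on a b y dy ->
  (forall t, t \in `]a, b[ -> `|dy t| <= M) ->
  forall s t, s \in `[a, b] -> t \in `[a, b] -> `|y t - y s| <= M * `|t - s|.
Proof.
move=> dy_ hM.
have key s t : s \in `[a, b] -> t \in `[a, b] -> s <= t ->
    `|y t - y s| <= M * `|t - s|.
  rewrite !in_itv /= => /andP[as_ _] /andP[_ tb].
  rewrite le_eqVlt => /predU1P[->|st]; first by rewrite !subrr normr0 mulr0.
  have [cy hy] := deriv_on_subsegment as_ tb dy_.
  have [r rst ->] := MVT st hy cy; rewrite normrM ler_wpM2r //.
  move: rst; rewrite in_itv /= => /andP[sr rt]; apply: hM.
  by rewrite in_itv /= (le_lt_trans as_ sr) (lt_le_trans rt tb).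
move=> s t sab tab; case: (leP s t) => [|/ltW] h; first exact: key.
by rewrite distrC (distrC t); exact: key.
Qed.

(* Both signs of the time direction are covered at once: [y s = 0] at one point
   [s] controls [y] to the left and to the right of [s]. *)
Lemma gronwall_scalar a b c eta s (y dy : R -> R) :
  deriv_on a b y dy -> 0 <= c -> 0 <= eta -> s \in `[a, b] -> y s = 0 ->
  (forall t, t \in `]a, b[ -> `|dy t| <= c * (y t + eta)) ->
  forall t, t \in `[a, b] -> y t + eta <= eta * expR (c * (b - a)).
Proof.
move=> [cy hy] c0 eta0 sab ys0 hdy t tab.
have cabs k : {within `[a, b], continuous (fun r => (y r + eta) * expR (k * r))}.
  move=> x; apply: cvgM; first by apply: cvgD; [exact: cy|exact: cvg_cst].
  apply: continuous_subspaceT => {}x.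
  apply: (@continuous_comp _ _ _ (fun r => k * r) expR).
    by apply: cvgM; [exact: cvg_cst|exact: cvg_id].
  exact: continuous_expR.
have dabs k r : r \in `]a, b[ -> is_derive r (1 : R)
    (fun r => (y r + eta) * expR (k * r)) ((dy r + k * (y r + eta)) * expR (k * r)).
  move=> rab; have hr := hy r rab.
  have h1 : is_derive r (1 : R) (fun r => y r + eta) (dy r + 0).
    by apply: is_deriveD.
  have h2 : is_derive r (1 : R) (fun r => expR (k * r)) (k * expR (k * r)).
    have h3 : is_derive r (1 : R) (fun r : R => k * r) (k * 1).
      by apply: is_deriveZ.
    have h4 := is_derive1_comp (is_derive_expR (k * r)) h3.
    by apply: is_derive_eq h4 _; ring.
  have h3 := is_deriveM h1 h2; apply: is_derive_eq h3 _.
  by rewrite /GRing.scale /=; ring.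
have e1 u v : u <= v -> u \in `[a, b] -> v \in `[a, b] ->
    expR (c * (v - u)) <= expR (c * (b - a)).
  rewrite !in_itv /= => uv /andP[au ub] /andP[av vb].
  by rewrite ler_expR ler_wpM2l // lerB.
case: (leP s t) => [st|/ltW ts].
- have := @deriv_on_ge0 a b (fun r => - ((y r + eta) * expR (- c * r)))
    (fun r => - ((dy r + - c * (y r + eta)) * expR (- c * r))).
  move=> /(_ _ _ s t sab tab st); rewrite lerN2 ys0 add0r => H.
  have {}H : (y t + eta) * expR (- c * t) <= eta * expR (- c * s).
    apply: H; first split.
    + by move=> x; apply: cvgN; exact: cabs.
    + by move=> r rab; apply: is_deriveN; exact: dabs.
    + move=> r rab; rewrite -mulNr mulr_ge0 ?expR_ge0 // oppr_ge0 mulNr subr_le0.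
      by apply: le_trans (hdy r rab); exact: ler_norm.
  apply: (@le_trans _ _ (eta * expR (c * (t - s)))); last by rewrite ler_wpM2l // e1.
  rewrite -(ler_pM2r (expR_gt0 (- c * t))); apply: le_trans H _.
  rewrite -mulrA -expRD le_eqVlt; apply/orP; left; apply/eqP.
  by congr (_ * expR _); ring.
- have := @deriv_on_ge0 a b (fun r => (y r + eta) * expR (c * r))
    (fun r => (dy r + c * (y r + eta)) * expR (c * r)).
  move=> /(_ _ _ t s tab sab ts); rewrite ys0 add0r => H.
  have {}H : (y t + eta) * expR (c * t) <= eta * expR (c * s).
    apply: H; first split.
    + by move=> x; exact: cabs.
    + by move=> r rab; exact: dabs.
    + move=> r rab; rewrite mulr_ge0 ?expR_ge0 // -lerBlDl sub0r.
      by apply: le_trans (hdy r rab); rewrite -normrN ler_norm.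
  apply: (@le_trans _ _ (eta * expR (c * (s - t)))); last by rewrite ler_wpM2l // e1.
  rewrite -(ler_pM2r (expR_gt0 (c * t))); apply: le_trans H _.
  rewrite -mulrA -expRD le_eqVlt; apply/orP; left; apply/eqP.
  by congr (_ * expR _); ring.
Qed.

Lemma deriv_on_sum (I : Type) (r : seq I) a b (y dy : I -> R -> R) :
  (forall i, deriv_on a b (y i) (dy i)) ->
  deriv_on a b (fun t => \sum_(i <- r) y i t) (fun t => \sum_(i <- r) dy i t).
Proof.
move=> h; split.
  move=> x; apply: cvg_big => [|i _]; first exact: add_continuous.
  exact: (h i).1.
move=> t tab; elim: r => [|i r IH].
  rewrite big_nil (_ : (fun _ => _) = cst 0); first exact: is_derive_cst.
  by apply/funext => u; rewrite big_nil.
rewrite big_cons (_ : (fun _ => _) = y i + fun u => \sum_(j <- r) y j u).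
  by apply: is_deriveD; exact: (h i).2.
by apply/funext => u; rewrite big_cons.
Qed.

Lemma deriv_on_mxP d e a b (y dy : R -> 'M[R]_(d, e)) :
  deriv_on a b y dy <->
  forall i j, deriv_on a b (fun t => y t i j) (fun t => dy t i j).
Proof.
split=> [[cy hy] i j|h]; split.
- by move=> x; have /cvg_mxP := cy x; apply.
- by move=> t tab; have /is_derive_mxP := hy t tab; apply.
- by move=> x; apply/cvg_mxP => i j; exact: (h i j).1.
- by move=> t tab; apply/is_derive_mxP => i j; exact: (h i j).2.
Qed.

Lemma deriv_on_mx_lip d e a b (y dy : R -> 'M[R]_(d, e)) M : 0 <= M ->
  deriv_on a b y dy -> (forall t, t \in `]a, b[ -> `|dy t| <= M) ->
  forall s t, s \in `[a, b] -> t \in `[a, b] -> `|y t - y s| <= M * `|t - s|.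
Proof.
move=> M0 /deriv_on_mxP dy_ hM s t sab tab.
apply: mxnorm_le => [|i j]; first by rewrite mulr_ge0.
rewrite !mxE; apply: (deriv_on_lip (dy_ i j)) => // r rab.
by apply: le_trans (hM r rab); exact: mxnorm_entry.
Qed.

Lemma lip_within (V : normedModType R) a b (y : R -> V) M :
  (forall s t, s \in `[a, b] -> t \in `[a, b] -> `|y t - y s| <= M * `|t - s|) ->
  {within `[a, b], continuous y}.
Proof.
move=> h; apply/subspace_continuousP => x xab; apply/cvgrPdist_le => e e0.
have d0 : 0 < e / (`|M| + 1) by rewrite divr_gt0 // ltr_wpDl.
rewrite near_withinE; near=> t => tab.
rewrite distrC; apply: le_trans (h _ _ xab tab) _.
apply: (@le_trans _ _ ((`|M| + 1) * `|t - x|)).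
  by rewrite ler_wpM2r // (le_trans (ler_norm _)) // lerDl.
rewrite mulrC -ler_pdivlMr ?ltr_wpDl // distrC; near: t.
Unshelve. all: by end_near. Qed.

Definition gronwall_const (d e : nat) (c l : R) : R :=
  expR (3 * (d * e)%:R * c * l).

Lemma gronwall_const_gt0 d e c l : 0 < gronwall_const d e c l.
Proof. exact: expR_gt0. Qed.

(* The maximum norm is not differentiable; the sum of the squares of the
   entries is, and it is equivalent to its square. *)
Lemma gronwall d e a b c eta s (y dy : R -> 'M[R]_(d, e)) :
  deriv_on a b y dy -> 0 <= c -> 0 <= eta -> s \in `[a, b] -> y s = 0 ->
  (forall t, t \in `]a, b[ -> `|dy t| <= c * (`|y t| + eta)) ->
  forall t, t \in `[a, b] -> `|y t| <= eta * gronwall_const d e c (b - a).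
Proof.
move=> dy_ c0 eta0 sab ys0 hdy.
pose E t := \sum_(ij : 'I_d * 'I_e) y t ij.1 ij.2 ^+ 2.
pose dE t := \sum_(ij : 'I_d * 'I_e) (2 * y t ij.1 ij.2 * dy t ij.1 ij.2).
have E_ge t : `|y t| ^+ 2 <= E t.
  have -> : `|y t| = mx_norm (y t) by [].
  have [|/mx_norm_neq0[ij]] := eqVneq (mx_norm (y t)) 0.
    move=> ->; rewrite expr0n /=; apply: sumr_ge0 => *.
    exact: sqr_ge0.
  move=> ->; rewrite real_normK ?num_real// /E (bigD1 ij) //=.
  by rewrite lerDl sumr_ge0 // => *; exact: sqr_ge0.
have DE : deriv_on a b E dE.
  apply: deriv_on_sum => ij; have /deriv_on_mxP/(_ ij.1 ij.2)[cy hy] := dy_.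
  split; first by move=> x; apply: cvgM; exact: cy.
  move=> t tab; have h3 := is_deriveM (hy t tab) (hy t tab).
  apply: is_derive_eq h3 _; rewrite /GRing.scale /=; ring.
move=> t tab; set k := 3 * (d * e)%:R * c.
have k0 : 0 <= k by rewrite /k !mulr_ge0.
have Es : E s = 0 by apply: big1 => ij _; rewrite ys0 mxE expr0n.
have := @gronwall_scalar a b k (eta ^+ 2) s E dE DE k0 (sqr_ge0 _) sab Es.
have hE r : r \in `]a, b[ -> `|dE r| <= k * (E r + eta ^+ 2).
  move=> rab; apply: le_trans (ler_norm_sum _ _ _) _.
  apply: (@le_trans _ _ (\sum_(ij : 'I_d * 'I_e) (3 * c * (`|y r| ^+ 2 + eta ^+ 2)))).
    apply: ler_sum => ij _; rewrite !normrM (ger0_norm (ler0n _ 2)).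
    apply: (@le_trans _ _ (2 * `|y r| * (c * (`|y r| + eta)))).
      apply: ler_pM; rewrite ?mulr_ge0 //.
        by rewrite ler_wpM2l // mxnorm_entry.
      by apply: le_trans (hdy r rab); exact: mxnorm_entry.
    have := normr_ge0 (y r); set u := `|y r| => u0.
    rewrite (_ : 2 * u * _ = c * (2 * u * (u + eta))); last by ring.
    rewrite (_ : 3 * c * _ = c * (3 * (u ^+ 2 + eta ^+ 2))); last by ring.
    rewrite ler_wpM2l //; have := sqr_ge0 (u - eta); have := sqr_ge0 u.
    have := sqr_ge0 eta; nra.
  rewrite sumr_const card_prod !card_ord -[leLHS]mulr_natl /k.
  rewrite (_ : _ * (3 * c * _) = 3 * (d * e)%:R * c * (`|y r| ^+ 2 + eta ^+ 2)).
    by rewrite ler_wpM2l // lerD2r.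
  by ring.
move=> /(_ hE t tab) H.
set g := gronwall_const _ _ _ _.
have g1 : 1 <= g.
  rewrite /g /gronwall_const -[leLHS]expR0 ler_expR; apply: mulr_ge0; first exact: k0.
  by rewrite subr_ge0; move: tab; rewrite in_itv /= => /andP[]; exact: le_trans.
have : `|y t| ^+ 2 <= (eta * g) ^+ 2.
  rewrite exprMn; apply: (@le_trans _ _ (eta ^+ 2 * g)).
    apply: le_trans (E_ge t) _; apply: le_trans H.
    by rewrite lerDl sqr_ge0.
  by rewrite ler_wpM2l ?sqr_ge0// expr2 ler_peMr // (le_trans ler01).
have g0 : 0 <= eta * g by rewrite mulr_ge0 // (le_trans ler01).
by rewrite ler_pXn2r ?nnegrE.
Qed.

End Segments.

(** * Oriented integrals *)

Section OrientedIntegral.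
Context {R : realType}.
Implicit Types A B a b s t : R.
Notation mu := (@lebesgue_measure R).

Lemma in_subsegment A B s t r : s \in `[A, B] -> t \in `[A, B] ->
  r \in `[s, t] -> r \in `[A, B].
Proof.
rewrite !in_itv /= => /andP[As _] /andP[_ tB] /andP[sr rt].
by rewrite (le_trans As sr) (le_trans rt tB).
Qed.

Lemma within_integrable A B s t (F : R -> R) :
  {within `[A, B], continuous F} -> s \in `[A, B] -> t \in `[A, B] ->
  mu.-integrable `[s, t] (EFin \o F).
Proof.
rewrite !in_itv /= => cF /andP[As _] /andP[_ tB].
apply: continuous_compact_integrable; first exact: segment_compact.
exact: within_subsegment cF.
Qed.

Lemma eq_oint A B a b (F G : R -> R) : a \in `[A, B] -> b \in `[A, B] ->
  (forall t, t \in `[A, B] -> F t = G t) -> oint a b F = oint a b G.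
Proof.
move=> aAB bAB FG; rewrite /oint; case: ifP => _; [|congr (- _)];
  apply: eq_Rintegral => t; rewrite inE /= => tab; apply: FG;
  exact: in_subsegment tab.
Qed.

Lemma oint_primitive A B (F : R -> R) : A < B ->
  {within `[A, B], continuous F} ->
  exists2 G : R -> R, deriv_on A B G F &
    forall s t, s \in `[A, B] -> t \in `[A, B] -> oint s t F = G t - G s.
Proof.
move=> AB cF; have AAB : A \in `[A, B] by rewrite in_itv /= lexx ltW.
have BAB : B \in `[A, B] by rewrite in_itv /= lexx ltW.
have iF := within_integrable cF AAB BAB.
exists (fun t => \int[mu]_(r in `[A, t]) F r); first split.
- exact: parameterized_integral_continuous (ltW AB) iF.
- move=> t tAB; have : t \in `]A, B[ := tAB; rewrite in_itv /= => /andP[At tB].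
  have [|h1 h2] := continuous_FTC1_closed tB iF At.
    exact: within_continuous_continuous AB cF tAB.
  by apply: DeriveDef => //; rewrite -derive1E.
have key s t : s \in `[A, B] -> t \in `[A, B] -> s <= t ->
    \int[mu]_(r in `[s, t]) F r =
    \int[mu]_(r in `[A, t]) F r - \int[mu]_(r in `[A, s]) F r.
  move=> sAB tAB st; rewrite Rintegral_itvB //.
  - rewrite Rintegral_itv_obnd_cbnd //.
    apply: integrableS (within_integrable cF sAB tAB) => //.
    exact: subset_itv_oc_cc.
  - exact: within_integrable cF AAB tAB.
  - by rewrite bnd_simp; move: sAB; rewrite in_itv /= => /andP[].
move=> s t sAB tAB; rewrite /oint; case: ifPn => [st|]; first by rewrite key.
by rewrite -ltNge => /ltW ts; rewrite key // opprB.
Qed.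

Lemma oint_chasles A B (F : R -> R) a b c : A < B ->
  {within `[A, B], continuous F} ->
  a \in `[A, B] -> b \in `[A, B] -> c \in `[A, B] ->
  oint a c F = oint a b F + oint b c F.
Proof.
move=> AB /(oint_primitive AB)[G _ GE] aAB bAB cAB.
by rewrite !GE //; ring.
Qed.

Lemma oint_norm_le A B (F : R -> R) a b M : A < B ->
  {within `[A, B], continuous F} -> a \in `[A, B] -> b \in `[A, B] ->
  (forall t, t \in `[A, B] -> `|F t| <= M) ->
  `|oint a b F| <= M * `|b - a|.
Proof.
move=> AB /(oint_primitive AB)[G dG GE] aAB bAB FM; rewrite GE //.
by apply: (deriv_on_lip dG) => // t /subset_itv_oo_cc; exact: FM.
Qed.

Lemma ointD A B (F G : R -> R) a b :
  {within `[A, B], continuous F} -> {within `[A, B], continuous G} ->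
  a \in `[A, B] -> b \in `[A, B] ->
  oint a b (fun t => F t + G t) = oint a b F + oint a b G.
Proof.
move=> cF cG aAB bAB; rewrite /oint; case: ifP => _; rewrite RintegralD ?opprD //;
  exact: within_integrable aAB bAB || exact: within_integrable bAB aAB.
Qed.

Lemma ointZ A B (F : R -> R) a b c : {within `[A, B], continuous F} ->
  a \in `[A, B] -> b \in `[A, B] ->
  oint a b (fun t => c * F t) = c * oint a b F.
Proof.
move=> cF aAB bAB; rewrite /oint; case: ifP => _; rewrite RintegralZl ?mulrN //;
  exact: within_integrable aAB bAB || exact: within_integrable bAB aAB.
Qed.

Lemma oint_sum A B (I : Type) (r : seq I) (c : I -> R) (F : I -> R -> R) a b :
  (forall i, {within `[A, B], continuous (F i)}) ->
  a \in `[A, B] -> b \in `[A, B] ->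
  oint a b (fun t => \sum_(i <- r) c i * F i t) = \sum_(i <- r) c i * oint a b (F i).
Proof.
move=> cF aAB bAB; elim: r => [|i r IH].
  rewrite big_nil; transitivity (oint a b (fun t => 0 * 0 : R)).
    by congr oint; apply/funext => t; rewrite big_nil mul0r.
  rewrite (@ointZ A B (fun=> 0)) // ?mul0r //.
  by move=> ?; exact: cvg_cst.
rewrite big_cons -IH -(ointZ _ (cF i)) // -(@ointD A B) //.
- by congr oint; apply/funext => t; rewrite big_cons.
- by move=> x; apply: cvgM; [exact: cvg_cst|exact: cF].
- move=> x; apply: cvg_big => [|j _]; first exact: add_continuous.
  by apply: cvgM; [exact: cvg_cst|exact: cF].
Qed.

Lemma oint_ge0 a b (F : R -> R) : a <= b ->
  (forall t, t \in `[a, b] -> 0 <= F t) -> 0 <= oint a b F.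
Proof. by move=> ab F0; rewrite /oint ab; exact: Rintegral_ge0. Qed.

Lemma oint_eq0 a b (F : R -> R) : a < b -> {within `[a, b], continuous F} ->
  (forall t, t \in `[a, b] -> 0 <= F t) -> oint a b F = 0 ->
  forall t, t \in `[a, b] -> F t = 0.
Proof.
move=> ab cF F0; have [G dG GE] := oint_primitive ab cF.
have aab : a \in `[a, b] by rewrite in_itv /= lexx ltW.
have bab : b \in `[a, b] by rewrite in_itv /= lexx ltW.
rewrite GE // => /eqP; rewrite subr_eq0 => /eqP Gba.
have Gcst t : t \in `[a, b] -> G t = G a.
  move=> tab; have : t \in `[a, b] := tab; rewrite in_itv /= => /andP[at_ tb].
  have mono := deriv_on_ge0 dG (fun r rab => F0 r (subset_itv_oo_cc rab)).
  by apply/eqP; rewrite eq_le -{1}Gba; apply/andP; split; exact: mono.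
have F0oo t : t \in `]a, b[ -> F t = 0.
  move=> tab; have [_ h] := dG; have [_ <-] := h t tab.
  rewrite -derive1E -(derive1_cst (G a) t).
  rewrite !derive1E; apply: near_eq_derive.
  near=> r; apply: Gcst; apply: subset_itv_oo_cc; near: r.
  exact: near_in_itvoo.
have [_ Fa Fb] := (continuous_within_itvP F ab).1 cF.
have Na : \forall r \near a^'+, F r = 0.
  apply: filterS2 (nbhs_right_gt a) (nbhs_right_lt ab) => r ar rb.
  by apply: F0oo; rewrite in_itv /= ar.
have La : F a = 0 by apply: (cvg_unique _ Fa) => //; exact: cvg_near_cst.
have Nb : \forall r \near b^'-, F r = 0.
  apply: filterS2 (nbhs_left_gt ab) (nbhs_left_lt b) => r ar rb.
  by apply: F0oo; rewrite in_itv /= ar.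
have Lb : F b = 0 by apply: (cvg_unique _ Fb) => //; exact: cvg_near_cst.
move=> t; rewrite in_itv /= !le_eqVlt.
move=> /andP[/predU1P[<- //|at_] /predU1P[-> //|tb]].
by apply: F0oo; rewrite in_itv /= at_.
Unshelve. all: by end_near. Qed.

End OrientedIntegral.

Section MatrixIntegral.
Context {R : realType}.
Implicit Types A B a b s t : R.

Lemma within_mxP d e A B (y : R -> 'M[R]_(d, e)) :
  {within `[A, B], continuous y} <->
  forall i j, {within `[A, B], continuous (fun t => y t i j)}.
Proof.
split=> [cy i j x|h x]; first by have /cvg_mxP := cy x; apply.
by apply/cvg_mxP => i j; exact: h.
Qed.

Lemma eq_mxint d e A B a b (y z : R -> 'M[R]_(d, e)) :
  a \in `[A, B] -> b \in `[A, B] ->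
  (forall t, t \in `[A, B] -> y t = z t) -> mxint a b y = mxint a b z.
Proof.
move=> aAB bAB yz; apply/matrixP => i j; rewrite !mxE.
by apply: (eq_oint aAB bAB) => t tAB; rewrite yz.
Qed.

Lemma mxintD d e A B a b (y z : R -> 'M[R]_(d, e)) :
  {within `[A, B], continuous y} -> {within `[A, B], continuous z} ->
  a \in `[A, B] -> b \in `[A, B] ->
  mxint a b (fun t => y t + z t) = mxint a b y + mxint a b z.
Proof.
move=> /within_mxP cy /within_mxP cz aAB bAB; apply/matrixP => i j; rewrite !mxE.
rewrite -(ointD (cy i j) (cz i j)) //.
by congr oint; apply/funext => t; rewrite mxE.
Qed.

Lemma mxint_mull d e k A B a b (C : 'M[R]_(k, d)) (y : R -> 'M[R]_(d, e)) :
  {within `[A, B], continuous y} -> a \in `[A, B] -> b \in `[A, B] ->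
  mxint a b (fun t => C *m y t) = C *m mxint a b y.
Proof.
move=> /within_mxP cy aAB bAB; apply/matrixP => i j; rewrite !mxE.
rewrite (_ : \sum_l _ = \sum_l C i l * oint a b (fun t => y t l j)).
  rewrite -(@oint_sum R A B) //.
  by congr oint; apply/funext => t; rewrite mxE.
by apply: eq_bigr => l _; rewrite mxE.
Qed.

Lemma mxint_tr d e a b (y : R -> 'M[R]_(d, e)) :
  mxint a b (fun t => (y t)^T) = (mxint a b y)^T.
Proof.
apply/matrixP => i j; rewrite !mxE.
by congr oint; apply/funext => t; rewrite mxE.
Qed.

Lemma mxint_mulr d e k A B a b (C : 'M[R]_(e, k)) (y : R -> 'M[R]_(d, e)) :
  {within `[A, B], continuous y} -> a \in `[A, B] -> b \in `[A, B] ->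
  mxint a b (fun t => y t *m C) = mxint a b y *m C.
Proof.
move=> cy aAB bAB; apply: trmx_inj; rewrite -mxint_tr trmx_mul -mxint_tr.
rewrite -(@mxint_mull e d k A B) //; first last.
  by move=> x; apply: cvg_trmx; exact: cy.
by congr mxint; apply/funext => t; rewrite trmx_mul.
Qed.

Lemma mxint_norm_le d e A B a b M (y : R -> 'M[R]_(d, e)) : A < B -> 0 <= M ->
  {within `[A, B], continuous y} -> a \in `[A, B] -> b \in `[A, B] ->
  (forall t, t \in `[A, B] -> `|y t| <= M) ->
  `|mxint a b y| <= M * `|b - a|.
Proof.
move=> AB M0 /within_mxP cy aAB bAB yM; apply: mxnorm_le; first by rewrite mulr_ge0.
move=> i j; rewrite mxE; apply: (oint_norm_le AB) => // t tAB.
by apply: le_trans (yM t tAB); exact: mxnorm_entry.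
Qed.

Lemma mxint_chasles d e A B (y : R -> 'M[R]_(d, e)) a b c : A < B ->
  {within `[A, B], continuous y} ->
  a \in `[A, B] -> b \in `[A, B] -> c \in `[A, B] ->
  mxint a c y = mxint a b y + mxint b c y.
Proof.
move=> AB /within_mxP cy aAB bAB cAB; apply/matrixP => i j; rewrite !mxE.
exact: (oint_chasles AB).
Qed.

Lemma mxintN d e A B a b (y : R -> 'M[R]_(d, e)) :
  {within `[A, B], continuous y} -> a \in `[A, B] -> b \in `[A, B] ->
  mxint a b (fun t => - y t) = - mxint a b y.
Proof.
move=> cy aAB bAB.
have -> : - mxint a b y = (- 1%:M) *m mxint a b y by rewrite mulNmx mul1mx.
rewrite -(@mxint_mull _ _ _ A B) //.
by congr mxint; apply/funext => t; rewrite mulNmx mul1mx.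
Qed.

Lemma mxintB d e A B a b (y z : R -> 'M[R]_(d, e)) :
  {within `[A, B], continuous y} -> {within `[A, B], continuous z} ->
  a \in `[A, B] -> b \in `[A, B] ->
  mxint a b (fun t => y t - z t) = mxint a b y - mxint a b z.
Proof.
move=> cy cz aAB bAB; rewrite -(mxintN cz) // -(@mxintD _ _ A B) //.
by move=> x; apply: cvgN; exact: cz.
Qed.

Lemma deriv_on_mxint d e A B (y Y : R -> 'M[R]_(d, e)) (C : 'M[R]_(d, e)) : A < B ->
  {within `[A, B], continuous y} ->
  (forall t, t \in `[A, B] -> Y t = C + mxint A t y) -> deriv_on A B Y y.
Proof.
move=> AB /within_mxP cy YE; apply/deriv_on_mxP => i j.
have AAB : A \in `[A, B] by rewrite in_itv /= lexx ltW.
have [G [cG dG] GE] := oint_primitive AB (cy i j).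
have YG t : t \in `[A, B] -> G t + (C i j - G A) = Y t i j.
  by move=> tAB; rewrite YE // !mxE GE //; ring.
split.
  apply: (@subspace_eq_continuous _ _ _ (fun t => G t + (C i j - G A))).
    by move=> t /[!inE]; exact: YG.
  by move=> x; apply: cvgD; [exact: cG|exact: cvg_cst].
move=> t tAB; have hG := dG t tAB.
have h : is_derive t (1 : R) (fun t => G t + (C i j - G A)) (y t i j + 0).
  by apply: is_deriveD.
rewrite addr0 in h; apply: near_eq_is_derive h.
near=> r; apply: YG; apply: subset_itv_oo_cc; near: r.
exact: near_in_itvoo.
Unshelve. all: by end_near. Qed.

End MatrixIntegral.

(** * State transition matrices *)

Section TransitionMatrix.
Context {R : realType} {n : nat}.
Implicit Types (a b s t : R) (A : R -> 'M[R]_n) (F : R -> R -> 'M[R]_n).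

Definition transition a b A F := forall s, s \in `[a, b] ->
  F s s = 1%:M /\ deriv_on a b (fun t => F t s) (fun t => A t *m F t s).

Lemma mxnorm1_le : `|1%:M : 'M[R]_n| <= 1.
Proof.
apply: mxnorm_le => // i j; rewrite mxE.
by case: (i == j); rewrite ?mulr1n ?mulr0n ?normr1 ?normr0.
Qed.

Definition transition_bound (M l : R) := 1 + gronwall_const n n (n%:R * M) l.

Lemma transition_bound_ge1 M l : 1 <= transition_bound M l.
Proof. by rewrite lerDl ltW // gronwall_const_gt0. Qed.

Lemma transition_bounded a b A F M : transition a b A F ->
  0 <= M -> (forall t, t \in `[a, b] -> `|A t| <= M) ->
  forall s t, s \in `[a, b] -> t \in `[a, b] ->
  `|F t s| <= transition_bound M (b - a).
Proof.
move=> hF M0 hA s t sab tab; have [Fss dF] := hF s sab.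
have d0 : deriv_on a b (fun t => F t s - 1%:M) (fun t => A t *m F t s - 0).
  apply: deriv_onB => //; split; first by move=> x; exact: cvg_cst.
  by move=> r _; exact: is_derive_cst.
have ys : F s s - 1%:M = 0 by rewrite Fss subrr.
have nM0 : 0 <= n%:R * M by rewrite mulr_ge0.
have := gronwall d0 nM0 ler01 sab ys.
have N r : `|F r s| <= `|F r s - 1%:M| + 1.
  rewrite -{1}(subrK 1%:M (F r s)); apply: le_trans (ler_normD _ _) _.
  by rewrite lerD2l mxnorm1_le.
have hr r : r \in `]a, b[ ->
    `|A r *m F r s - 0| <= n%:R * M * (`|F r s - 1%:M| + 1).
  move=> rab; rewrite subr0; apply: le_trans (mxnorm_mul _ _) _.
  apply: ler_pM; rewrite ?mulr_ge0 ?N //.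
  by rewrite ler_wpM2l // hA // subset_itv_oo_cc.
move=> /(_ hr t tab); rewrite mul1r => H; apply: le_trans (N t) _.
by rewrite addrC lerD2l.
Qed.

Lemma transition_diff a b A F A' F' M eta : transition a b A F ->
  transition a b A' F' -> 0 <= M -> 0 <= eta ->
  (forall t, t \in `[a, b] -> `|A t| <= M) ->
  (forall t, t \in `[a, b] -> `|A' t| <= M) ->
  (forall t, t \in `[a, b] -> `|A' t - A t| <= eta) ->
  forall s t, s \in `[a, b] -> t \in `[a, b] ->
  `|F' t s - F t s| <= eta * transition_bound M (b - a)
                         * gronwall_const n n (n%:R * (M + 1)) (b - a).
Proof.
move=> hF hF' M0 eta0 hA hA' hAA s t sab tab.
have [Fss dF] := hF s sab; have [Fss' dF'] := hF' s sab.
set B := transition_bound _ _.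
have B0 : 0 <= B by apply: le_trans (transition_bound_ge1 _ _).
have c0 : 0 <= n%:R * (M + 1) by rewrite mulr_ge0 // addr_ge0.
apply: (gronwall (deriv_onB dF' dF) c0 _ sab) => //.
- by rewrite mulr_ge0.
- by rewrite Fss Fss' subrr.
move=> r /subset_itv_oo_cc rab.
rewrite (_ : _ - _ = A' r *m (F' r s - F r s) + (A' r - A r) *m F r s); last first.
  by rewrite mulmxBr mulmxBl addrA subrK.
apply: le_trans (ler_normD _ _) _.
have h1 : `|A' r *m (F' r s - F r s)| <= n%:R * ((M + 1) * `|F' r s - F r s|).
  apply: le_trans (mxnorm_mul _ _) _; rewrite -mulrA ler_wpM2l // ler_wpM2r //.
  by rewrite (le_trans (hA' r rab)) // lerDl.
have h2 : `|(A' r - A r) *m F r s| <= n%:R * ((M + 1) * (eta * B)).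
  apply: le_trans (mxnorm_mul _ _) _; rewrite -mulrA ler_wpM2l //.
  apply: (@le_trans _ _ (eta * B)).
    by rewrite ler_pM // ?hAA // (transition_bounded hF).
  by rewrite ler_peMl ?mulr_ge0 // lerDr.
by apply: le_trans (lerD h1 h2) _; rewrite -mulrDr -mulrDr mulrA.
Qed.

Lemma transition_semigroup a b A F M r s t : transition a b A F -> 0 <= M ->
  (forall t, t \in `[a, b] -> `|A t| <= M) ->
  r \in `[a, b] -> s \in `[a, b] -> t \in `[a, b] -> F t r = F t s *m F s r.
Proof.
move=> hF M0 hA rab sab tab; apply/eqP; rewrite -subr_eq0 -normr_le0.
have [_ dFr] := hF r rab; have [Fss dFs] := hF s sab.
have dFs' : deriv_on a b (fun t => F t s *m F s r) (fun t => A t *m (F t s *m F s r)).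
  apply/deriv_on_mxP => i j; have /deriv_on_mxP dF := dFs.
  have -> : (fun t => (A t *m (F t s *m F s r)) i j) =
            fun t => \sum_k (A t *m F t s) i k * F s r k j.
    by apply/funext => u; rewrite mulmxA mxE.
  have -> : (fun t => (F t s *m F s r) i j) = fun t => \sum_k F t s i k * F s r k j.
    by apply/funext => u; rewrite mxE.
  apply: deriv_on_sum => k; have [cF hFk] := dF i k; split.
    by move=> x; apply: cvgM; [exact: cF|exact: cvg_cst].
  move=> u uab; have h := is_deriveM (hFk u uab) (is_derive_cst (F s r k j) u 1).
  by apply: is_derive_eq h _; rewrite /GRing.scale /=; ring.
have := @gronwall R n n a b (n%:R * M) 0 s _ _ (deriv_onB dFr dFs').
rewrite mul0r; apply => //; first by rewrite mulr_ge0.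
- by rewrite Fss mul1mx subrr.
move=> u /subset_itv_oo_cc uab; rewrite -mulmxBr addr0.
apply: le_trans (mxnorm_mul _ _) _.
by rewrite ler_wpM2r // ler_wpM2l // hA.
Qed.

Lemma transition_lip a b A F M : transition a b A F -> 0 <= M ->
  (forall t, t \in `[a, b] -> `|A t| <= M) ->
  forall s r t, s \in `[a, b] -> r \in `[a, b] -> t \in `[a, b] ->
  `|F t s - F r s| <= n%:R * M * transition_bound M (b - a) * `|t - r|.
Proof.
move=> hF M0 hA s r t sab rab tab; have [_ dF] := hF s sab.
apply: (deriv_on_mx_lip _ dF) => //.
  by rewrite !mulr_ge0 // (le_trans _ (transition_bound_ge1 _ _)).
move=> u /subset_itv_oo_cc uab; apply: le_trans (mxnorm_mul _ _) _.
apply: ler_pM; rewrite ?mulr_ge0 //; last exact: (transition_bounded hF).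
by rewrite ler_wpM2l // hA.
Qed.

Lemma transition_continuous2 a b A F M t : transition a b A F -> 0 <= M ->
  (forall t, t \in `[a, b] -> `|A t| <= M) -> t \in `[a, b] ->
  {within `[a, b], continuous (fun s => F t s)}.
Proof.
move=> hF M0 hA tab; set B := transition_bound M (b - a).
have B0 : 0 <= B by apply: le_trans (transition_bound_ge1 _ _).
apply: (@lip_within _ _ _ _ _ (n%:R * B * (n%:R * M * B))) => s r sab rab.
rewrite (transition_semigroup hF M0 hA sab rab tab).
rewrite -{1}(mulmx1 (F t r)) -(hF s sab).1 -mulmxBr.
apply: le_trans (mxnorm_mul _ _) _.
rewrite -[leRHS]mulrA; apply: ler_pM; rewrite ?mulr_ge0 //.
  by rewrite ler_wpM2l // (transition_bounded hF).
by rewrite (distrC r); apply: (transition_lip hF).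
Qed.

End TransitionMatrix.

Lemma continuous_entry (R : realType) (Z : topologicalType) d e
    (F : Z -> 'M[R]_(d, e)) i j :
  continuous F -> continuous (fun z => F z i j).
Proof. by move=> cF z; have /cvg_mxP := cF z; exact. Qed.

Lemma cvg_pair_nbhs {T : Type} {U V : topologicalType} {F : set_system T}
    {FF : Filter F} (y : T -> U) (z : T -> V) (a : U) (b : V) :
  y @ F --> a -> z @ F --> b -> (fun t => (y t, z t)) @ F --> (a, b).
Proof. exact: cvg_pair. Qed.

Lemma cvg_app {T : Type} {U V : topologicalType} {F : set_system T}
    {FF : Filter F} (y : T -> U) (G : U -> V) (a : U) :
  y @ F --> a -> {for a, continuous G} -> (fun t => G (y t)) @ F --> G a.
Proof. exact: cvg_comp. Qed.

Section Trajectory.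
Context {R : realType} {n m q : nat}.
Variables (P : ocp R n m q) (w : traj R n m) (T : R).
Hypotheses (hP : regular P) (hw : continued P w T) (t0T : t0 P < T).
Hypothesis tfT : tf w \in `[t0 P, T].

Lemma within_zt : {within `[t0 P, T], continuous (zt w)}.
Proof.
have [cu cx _ _] := hw => x.
apply: cvg_pair_nbhs; last by apply: continuous_subspaceT => {}x; exact: cvg_id.
by apply: cvg_pair_nbhs; [exact: cx|exact: cu].
Qed.

Lemma within_along (V : topologicalType) (F : 'cV[R]_n * 'cV[R]_m * R -> V) :
  continuous F -> {within `[t0 P, T], continuous (fun t => F (zt w t))}.
Proof.
move=> cF x; apply: (cvg_app (F := nbhs x) (y := zt w) (G := F)); last exact: cF.
exact: within_zt.
Qed.

Lemma regular_fx j : continuous ('D_(dirx j) (f P)).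
Proof. by have [_ _ [[_ h] _] _] := hP; apply: (h _ _).2; left; left; exists j. Qed.

Lemma regular_fu j : continuous ('D_(diru j) (f P)).
Proof. by have [_ _ [[_ h] _] _] := hP; apply: (h _ _).2; left; right; exists j. Qed.

Lemma regular_Lx j : continuous ('D_(dirx j) (Lag P)).
Proof. by have [[_ h] _ _ _] := hP; apply: (h _ _).2; left; left; exists j. Qed.

Lemma regular_Lu j : continuous ('D_(diru j) (Lag P)).
Proof. by have [[_ h] _ _ _] := hP; apply: (h _ _).2; left; right; exists j. Qed.

Lemma within_fx : {within `[t0 P, T], continuous (fx P w)}.
Proof.
apply/within_mxP => i j.
rewrite (_ : (fun _ => _) = fun t => 'D_(dirx j) (f P) (zt w t) i 0); last first.
  by apply/funext => t; rewrite mxE.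
apply: (within_along (F := fun z => 'D_(dirx j) (f P) z i 0)).
by apply: continuous_entry; exact: regular_fx.
Qed.

Lemma within_fu : {within `[t0 P, T], continuous (fu P w)}.
Proof.
apply/within_mxP => i j.
rewrite (_ : (fun _ => _) = fun t => 'D_(diru j) (f P) (zt w t) i 0); last first.
  by apply/funext => t; rewrite mxE.
apply: (within_along (F := fun z => 'D_(diru j) (f P) z i 0)).
by apply: continuous_entry; exact: regular_fu.
Qed.

Lemma within_Lx : {within `[t0 P, T], continuous (Lx P w)}.
Proof.
apply/within_mxP => j k.
rewrite (_ : (fun _ => _) = fun t => 'D_(dirx j) (Lag P) (zt w t)).
  by apply: (within_along (F := 'D_(dirx j) (Lag P))); exact: regular_Lx.
by apply/funext => t; rewrite mxE.
Qed.

Lemma within_Lu : {within `[t0 P, T], continuous (Lu P w)}.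
Proof.
apply/within_mxP => j k.
rewrite (_ : (fun _ => _) = fun t => 'D_(diru j) (Lag P) (zt w t)).
  by apply: (within_along (F := 'D_(diru j) (Lag P))); exact: regular_Lu.
by apply/funext => t; rewrite mxE.
Qed.

Lemma deriv_on_st : deriv_on (t0 P) T (st w) (fun t => f P (zt w t)).
Proof.
have [_ _ hx _] := hw; apply: deriv_on_mxint hx => //.
by apply: (within_along (F := f P)); have [_ _ [[]]] := hP.
Qed.

Lemma transition_Phi : transition (t0 P) T (fx P w) (Phi w).
Proof. by have [_ _ _] := hw. Qed.

Lemma fx_bounded :
  exists2 M : R, 0 <= M & forall t, t \in `[t0 P, T] -> `|fx P w t| <= M.
Proof. exact: within_bounded within_fx. Qed.

Lemma within_Phi1 s : s \in `[t0 P, T] ->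
  {within `[t0 P, T], continuous (fun t => Phi w t s)}.
Proof. by move=> /transition_Phi[_ []]. Qed.

Lemma within_Phi2 t : t \in `[t0 P, T] ->
  {within `[t0 P, T], continuous (fun s => Phi w t s)}.
Proof.
have [M M0 hM] := fx_bounded.
exact: (transition_continuous2 transition_Phi M0 hM).
Qed.

Lemma within_mxint_upto d e c (y : R -> 'M[R]_(d, e)) : c \in `[t0 P, T] ->
  {within `[t0 P, T], continuous y} ->
  {within `[t0 P, T], continuous (fun t => mxint t c y)}.
Proof.
move=> cT cy; have AT : t0 P \in `[t0 P, T] by rewrite in_itv /= lexx ltW.
apply: (@subspace_eq_continuous _ _ _ (fun t => mxint (t0 P) c y - mxint (t0 P) t y)).
  move=> t /[!inE] tT.
  by rewrite (mxint_chasles t0T cy AT tT cT) addrC addKr.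
move=> x; apply: cvgB; first exact: cvg_cst.
have [] := @deriv_on_mxint R d e (t0 P) T y (fun t => mxint (t0 P) t y) 0 t0T cy.
  by move=> t _; rewrite add0r.
by move=> + _; exact.
Qed.

(* The semigroup property moves the second argument of [Phi] out of the
   integral, whose integrand then no longer depends on [t]. *)
Lemma mxint_Phi t : t \in `[t0 P, T] ->
  mxint t (tf w) (fun s => (Phi w s t)^T *m Lx P w s) =
  (Phi w (tf w) t)^T *m mxint t (tf w) (fun s => (Phi w s (tf w))^T *m Lx P w s).
Proof.
move=> tT; have [M M0 hM] := fx_bounded.
rewrite -(@mxint_mull _ _ _ _ (t0 P) T) //.
  apply: (@eq_mxint _ _ _ (t0 P) T) => // s sT.
  by rewrite mulmxA -trmx_mul -(transition_semigroup transition_Phi M0 hM).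
move=> x; apply: cvg_mulmx; last exact: within_Lx.
by apply: cvg_trmx; exact: within_Phi1.
Qed.

Lemma within_costate pi : {within `[t0 P, T], continuous (costate P w pi)}.
Proof.
pose h t := (Phi w (tf w) t)^T *m (phix P w + (gx P w)^T *m pi)
  + (Phi w (tf w) t)^T *m mxint t (tf w) (fun s => (Phi w s (tf w))^T *m Lx P w s).
apply: (@subspace_eq_continuous _ _ _ h).
  move=> t /[!inE] tT; change (h t = costate P w pi t).
  by rewrite /h /costate -(mxint_Phi tT).
have cP x : (fun t => (Phi w (tf w) t)^T) @ nbhs (x : subspace `[t0 P, T])
    --> (Phi w (tf w) x)^T.
  by apply: cvg_trmx; exact: within_Phi2.
move=> x; apply: cvgD; apply: cvg_mulmx; [exact: cP|exact: cvg_cst|exact: cP|].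
apply: within_mxint_upto => // {}x; apply: cvg_mulmx; last exact: within_Lx.
by apply: cvg_trmx; exact: within_Phi1.
Qed.

Lemma pu_costate pi t :
  pu P w t + (fu P w t)^T *m (Phi w (tf w) t)^T *m (gx P w)^T *m pi =
  Lu P w t + (fu P w t)^T *m costate P w pi t.
Proof.
by rewrite /pu /costate !mulmxDr !mulmxA -!addrA; congr (_ + (_ + _)); rewrite addrC.
Qed.

End Trajectory.

(** * Positive definite and Gram matrices *)

Section PositiveDefinite.
Context {R : realType}.

Lemma posdef_unit d (A : 'M[R]_d) : posdef A -> A \in unitmx.
Proof.
move=> [Asym Apos]; rewrite -row_free_unit -kermx_eq0; apply/negPn/negP.
move=> /rowV0Pn[v /sub_kermxP vA v0].
have := Apos v^T; rewrite trmx_eq0 v0 trmxK vA mul0mx mxE ltxx.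
by move/(_ isT).
Qed.

Lemma posdef_ge0 d (A : 'M[R]_d) (v : 'cV[R]_d) :
  posdef A -> 0 <= (v^T *m A *m v) 0 0.
Proof.
move=> [_ h]; have [->|v0] := eqVneq v 0; last exact: ltW (h v v0).
by rewrite mulmx0 mxE.
Qed.

Lemma posdef_inv d (A : 'M[R]_d) : posdef A -> posdef (invmx A).
Proof.
move=> hA; have uA := posdef_unit hA; have [Asym Apos] := hA.
have iAsym : (invmx A)^T = invmx A by rewrite trmx_inv Asym.
split=> // v v0; have := Apos (invmx A *m v).
rewrite trmx_mul iAsym -!mulmxA mulKVmx //; apply.
by apply: contraNneq v0 => h; rewrite -(mulKVmx uA v) h mulmx0.
Qed.

(* If [M] is positive semidefinite and [|M^-1| <= C], then [|v|^2 <= C v^T M v]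
   up to a dimensional constant: expand the square of [a v - M^-1 v], with
   [a = d^2 C], in the form [M]. *)
Lemma semidefinite_coercive d (M : 'M[R]_d) C (v : 'cV[R]_d) : M^T = M ->
  M \in unitmx -> `|invmx M| <= C ->
  (forall z : 'cV[R]_d, 0 <= (z^T *m M *m z) 0 0) ->
  `|v| ^+ 2 <= (d%:R ^+ 2 * C) * (v^T *m M *m v) 0 0.
Proof.
move=> Msym uM hC hpos; have iMsym : (invmx M)^T = invmx M by rewrite trmx_inv Msym.
set a := d%:R ^+ 2 * C.
have C0 : 0 <= C by apply: le_trans hC.
have a0 : 0 <= a by rewrite mulr_ge0 // sqr_ge0.
have := hpos (a *: v - invmx M *m v).
have -> : ((a *: v - invmx M *m v)^T *m M *m (a *: v - invmx M *m v)) 0 0 =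
  a ^+ 2 * (v^T *m M *m v) 0 0 - 2 * a * (v^T *m v) 0 0 + (v^T *m invmx M *m v) 0 0.
  have -> : (a *: v - invmx M *m v)^T *m M = a *: (v^T *m M) - v^T.
    rewrite linearB /= linearZ /= trmx_mul iMsym mulmxBl -scalemxAl.
    by rewrite -mulmxA mulVmx // mulmx1.
  rewrite mulmxBr !mulmxBl -!scalemxAr -!scalemxAl !mulmxA.
  rewrite -(mulmxA v^T M (invmx M)) mulmxV // mulmx1 !mxE.
  by ring.
have h1 := sqr_le_dot v.
have h2 : (v^T *m invmx M *m v) 0 0 <= a * `|v| ^+ 2.
  apply: le_trans (ler_norm _) _; apply: le_trans (quad_le _ _) _.
  by rewrite ler_wpM2r ?sqr_ge0 // ler_wpM2l // sqr_ge0.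
set Q := (v^T *m M *m v) 0 0; set D := (v^T *m v) 0 0 in h1 *.
set N := `|v| ^+ 2 in h1 h2 *; set I := (v^T *m invmx M *m v) 0 0 in h2 *.
move=> h.
have h3 : a * N <= a * (a * Q) by nra.
have [a00|ap] := eqVneq a 0; last first.
  by rewrite ler_pM2l // lt0r ap in h3.
have : `|v| = 0.
  have h4 : `|v| <= d%:R * `|invmx M| * `|M *m v|.
    by apply: le_trans (mxnorm_mul _ _); rewrite mulKmx.
  have := a00; rewrite /a => /eqP; rewrite mulf_eq0 expf_eq0 /= => /orP[/eqP d0|/eqP C00].
    by apply/eqP; rewrite -normr_le0 normr_id; move: h4; rewrite d0 !mul0r.
  apply/eqP; rewrite -normr_le0 normr_id; apply: le_trans h4 _.
  have -> : `|invmx M| = 0 by apply/eqP; rewrite -normr_le0 normr_id -C00.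
  by rewrite mulr0 mul0r.
by rewrite /N => ->; rewrite expr0n /= a00 mul0r.
Qed.

Section Bessel.
Variables (m s : nat) (a b : R) (K : R -> 'M[R]_m) (V : R -> 'M[R]_(m, s)).
Hypotheses (ab : a < b) (cK : {within `[a, b], continuous K}).
Hypothesis hK : forall t, t \in `[a, b] -> posdef (K t).
Hypothesis cV : {within `[a, b], continuous V}.
Hypothesis freeV : forall c : 'cV[R]_s,
  (forall t, t \in `[a, b] -> V t *m c = 0) -> c = 0.

Let aab : a \in `[a, b]. Proof. by rewrite in_itv /= lexx ltW. Qed.
Let bab : b \in `[a, b]. Proof. by rewrite in_itv /= lexx ltW. Qed.

Lemma within_invmx : {within `[a, b], continuous (fun t => invmx (K t))}.
Proof.
pose K' t := if t \in `[a, b] then K t else 1%:M.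
have uK t : K' t \in unitmx.
  by rewrite /K'; case: ifPn => [/hK/posdef_unit|_] //; exact: unitmx1.
apply: (@subspace_eq_continuous _ _ _ (fun t => invmx (K' t))).
  move=> t /[!inE] tab; change (invmx (K' t) = invmx (K t)).
  by rewrite /K' tab.
have cK' : {within `[a, b], continuous K'}.
  apply: subspace_eq_continuous cK => t /[!inE] tab; change (K t = K' t).
  by rewrite /K' tab.
by move=> x; apply: cvg_invmx => //; exact: cK'.
Qed.

Definition gram := mxint a b (fun t => (V t)^T *m invmx (K t) *m V t).

Lemma within_gram :
  {within `[a, b], continuous (fun t => (V t)^T *m invmx (K t) *m V t)}.
Proof.
move=> x; apply: cvg_mulmx; last exact: cV.
by apply: cvg_mulmx; [apply: cvg_trmx; exact: cV|exact: within_invmx].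
Qed.

Lemma gram_quad (c : 'cV[R]_s) : (c^T *m gram *m c) 0 0 =
  oint a b (fun t => ((V t *m c)^T *m invmx (K t) *m (V t *m c)) 0 0).
Proof.
rewrite -(mxint_mull _ within_gram) // -(@mxint_mulr _ _ _ _ a b) //; last first.
  by move=> x; apply: cvg_mulmx; [exact: cvg_cst|exact: within_gram].
rewrite mxE; congr oint; apply/funext => t.
by rewrite trmx_mul !mulmxA.
Qed.

Lemma posdef_gram : posdef gram.
Proof.
split.
  rewrite -mxint_tr; apply: (eq_mxint aab bab) => t tab.
  rewrite !trmx_mul trmxK mulmxA.
  by have [-> _] := posdef_inv (hK tab).
move=> c c0; rewrite gram_quad.
have ge0 t : t \in `[a, b] -> 0 <= ((V t *m c)^T *m invmx (K t) *m (V t *m c)) 0 0.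
  by move=> tab; apply: posdef_ge0; exact/posdef_inv/hK.
rewrite lt0r oint_ge0 // ?ltW // andbT; apply: contra_neq c0 => int0.
apply: freeV => t tab; apply/eqP/negPn/negP => Vc0.
have := oint_eq0 ab _ ge0 int0 tab => /=.
have cVc x : (fun t => V t *m c) @ nbhs (x : subspace `[a, b]) --> V x *m c.
  by apply: cvg_mulmx; [exact: cV|exact: cvg_cst].
have [_ /(_ _ Vc0) h] := posdef_inv (hK tab).
move=> H; move: h; rewrite H ?ltxx //.
have /within_mxP : {within `[a, b], continuous
    (fun t => (V t *m c)^T *m invmx (K t) *m (V t *m c))}; last exact.
move=> x; apply: cvg_mulmx; last exact: cVc.
by apply: cvg_mulmx; [apply: cvg_trmx; exact: cVc|exact: within_invmx].
Qed.

(* The left-hand side is the squared norm of the orthogonal projection of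
   [K e] on the span of the columns of [V], for the scalar product
   [int u^T K^-1 v]. *)
Lemma bessel (e : R -> 'cV[R]_m) (r := mxint a b (fun t => (V t)^T *m e t)) :
  {within `[a, b], continuous e} ->
  (r^T *m invmx gram *m r) 0 0 <= oint a b (fun t => ((e t)^T *m K t *m e t) 0 0).
Proof.
move=> ce; have pG := posdef_gram; have uG := posdef_unit pG; have [Gsym _] := pG.
pose c := invmx gram *m r.
have rE : (r^T *m invmx gram *m r) 0 0 = (c^T *m gram *m c) 0 0.
  by rewrite /c trmx_mul trmx_inv Gsym -!mulmxA mulKVmx.
have rE2 : (r^T *m invmx gram *m r) 0 0 = oint a b (fun t => (c^T *m ((V t)^T *m e t)) 0 0).
  have cVe : {within `[a, b], continuous (fun t => (V t)^T *m e t)}.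
    by move=> x; apply: cvg_mulmx; [apply: cvg_trmx; exact: cV|exact: ce].
  transitivity ((c^T *m r) 0 0); first by rewrite /c trmx_mul trmx_inv Gsym.
  by rewrite -(mxint_mull _ cVe) // mxE.
rewrite gram_quad in rE.
pose y t := ((e t)^T *m K t *m e t) 0 0.
pose z t := (c^T *m ((V t)^T *m e t)) 0 0.
pose g t := ((V t *m c)^T *m invmx (K t) *m (V t *m c)) 0 0.
have cVc x : (fun t => V t *m c) @ nbhs (x : subspace `[a, b]) --> V x *m c.
  by apply: cvg_mulmx; [exact: cV|exact: cvg_cst].
have entry (A : R -> 'M[R]_1) : {within `[a, b], continuous A} ->
    {within `[a, b], continuous (fun t => A t 0 0)}.
  by move=> /within_mxP; exact.
have cy : {within `[a, b], continuous y}.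
  apply: entry => x; apply: cvg_mulmx; last exact: ce.
  by apply: cvg_mulmx; [apply: cvg_trmx; exact: ce|exact: cK].
have cz : {within `[a, b], continuous z}.
  apply: entry => x; apply: cvg_mulmx; first exact: cvg_cst.
  by apply: cvg_mulmx; [apply: cvg_trmx; exact: cV|exact: ce].
have cg : {within `[a, b], continuous g}.
  apply: entry => x; apply: cvg_mulmx; last exact: cVc.
  by apply: cvg_mulmx; [apply: cvg_trmx; exact: cVc|exact: within_invmx].
have c2z : {within `[a, b], continuous (fun t => -2 * z t)}.
  by move=> x; apply: cvgM; [exact: cvg_cst|exact: cz].
have : 0 <= oint a b (fun t => (y t + -2 * z t) + g t).
  apply: oint_ge0 => [|t tab]; first exact: ltW.
  have uK := posdef_unit (hK tab); have [Ksym _] := hK tab.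
  have iKsym : (invmx (K t))^T = invmx (K t) by rewrite trmx_inv Ksym.
  have := posdef_ge0 (K t *m e t - V t *m c) (posdef_inv (hK tab)).
  have -> : (K t *m e t - V t *m c)^T *m invmx (K t) =
            (e t)^T - (V t *m c)^T *m invmx (K t).
    by rewrite linearB /= trmx_mul Ksym mulmxBl -mulmxA mulmxV // mulmx1.
  rewrite mulmxBr !mulmxBl.
  have -> : (V t *m c)^T *m invmx (K t) *m (K t *m e t) = c^T *m ((V t)^T *m e t).
    by rewrite trmx_mul -!mulmxA mulKmx.
  have -> : (e t)^T *m (V t *m c) = (c^T *m ((V t)^T *m e t))^T.
    by rewrite !trmx_mul !trmxK mulmxA.
  rewrite /y /z /g !mulmxA => h.
  apply: le_trans h _; rewrite !mxE /= le_eqVlt; apply/orP; left; apply/eqP.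
  by ring.
have cyz : {within `[a, b], continuous (fun t => y t + -2 * z t)}.
  by move=> x; apply: cvgD; [exact: cy|exact: c2z].
rewrite (ointD cyz cg) // (ointD cy c2z) // (ointZ _ cz) //.
by rewrite -/z in rE2; rewrite -/g in rE; rewrite -rE -rE2 => h; lra.
Qed.

End Bessel.

End PositiveDefinite.

Section Multiplier.
Context {R : realType} {n m q s : nat}.
Variables (P : ocp R n m q) (w : traj R n m) (T : R).
Variables (K : R -> 'M[R]_m) (ktf : R) (U : R -> 'cV[R]_s -> 'cV[R]_m).
Variable p : 'cV[R]_s.
Hypotheses (hP : regular P) (hw : continued P w T).
Hypotheses (t0f : t0 P < tf w) (tfT : tf w <= T).
Hypothesis cK : {within `[t0 P, tf w], continuous K}.
Hypothesis hK : forall t, t \in `[t0 P, tf w] -> posdef (K t).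
Hypothesis hU : parameterized P w U p.
Hypothesis ktf0 : 0 <= ktf.

Let t0T : t0 P < T. Proof. exact: lt_le_trans tfT. Qed.
Let tfin : tf w \in `[t0 P, T]. Proof. by rewrite in_itv /= ltW. Qed.
Let aab : t0 P \in `[t0 P, tf w]. Proof. by rewrite in_itv /= lexx ltW. Qed.
Let bab : tf w \in `[t0 P, tf w]. Proof. by rewrite in_itv /= lexx ltW. Qed.

Let sub (V : topologicalType) (y : R -> V) : {within `[t0 P, T], continuous y} ->
  {within `[t0 P, tf w], continuous y}.
Proof. exact: within_subsegment. Qed.

(* The left-hand side of the stationarity condition on the control. *)
Definition stationarity_gap (pi : 'cV[R]_q) t :=
  Lu P w t + (fu P w t)^T *m costate P w pi t.

Lemma within_stationarity_gap pi :
  {within `[t0 P, T], continuous (stationarity_gap pi)}.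
Proof.
move=> x; apply: cvgD; first exact: within_Lu.
by apply: cvg_mulmx; [apply: cvg_trmx; exact: within_fu|exact: within_costate].
Qed.

Lemma r1p_Gam1p pi : r1p P w U p + Gam1p P w U p *m pi =
  mxint (t0 P) (tf w) (fun t => (up U p t)^T *m stationarity_gap pi t).
Proof.
have [_ _ cup _] := hU.
have cupT x : (fun t => (up U p t)^T) @ nbhs (x : subspace `[t0 P, tf w])
    --> (up U p x)^T.
  by apply: cvg_trmx; exact: cup.
have cfu := sub (within_fu hP hw).
have cPhi := sub (within_Phi2 hP hw tfin).
have cpu : {within `[t0 P, tf w], continuous (pu P w)}.
  have -> : pu P w = stationarity_gap 0; last by apply: sub; exact: within_stationarity_gap.
  by apply/funext => t; rewrite /stationarity_gap -pu_costate mulmx0 addr0.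
have c1 : {within `[t0 P, tf w], continuous (fun t => (up U p t)^T *m pu P w t)}.
  by move=> x; apply: cvg_mulmx; [exact: cupT|exact: cpu].
have c2 : {within `[t0 P, tf w], continuous
    (fun t => (up U p t)^T *m (fu P w t)^T *m (Phi w (tf w) t)^T)}.
  move=> x; apply: cvg_mulmx; last by apply: cvg_trmx; exact: cPhi.
  by apply: cvg_mulmx; [exact: cupT|apply: cvg_trmx; exact: cfu].
rewrite /r1p /Gam1p -mulmxA -(mxint_mulr _ c2) // -(mxintD c1) //.
  apply: (eq_mxint aab bab) => t _; rewrite /stationarity_gap -pu_costate [RHS]mulmxDr.
  by rewrite !mulmxA.
by move=> x; apply: cvg_mulmx; [exact: c2|exact: cvg_cst].
Qed.

Lemma posdef_Mp : posdef (Mp P w K U p).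
Proof. by have [_ _ cup freeU] := hU; exact: posdef_gram. Qed.

Lemma M1pi_quad (z : 'cV[R]_q) : (z^T *m M1pi P w K ktf U p *m z) 0 0 =
  ((Gam1p P w U p *m z)^T *m invmx (Mp P w K U p) *m (Gam1p P w U p *m z)) 0 0
  + ktf * ((z^T *m gdot P w) 0 0) ^+ 2.
Proof.
rewrite /M1pi mulmxDr mulmxDl mxE; congr (_ + _).
  by rewrite (trmx_mul (Gam1p P w U p) z) !mulmxA.
rewrite -scalemxAr -scalemxAl mxE; congr (_ * _).
set X := z^T *m gdot P w.
have -> : z^T *m (gdot P w *m (gdot P w)^T) *m z = X *m X^T.
  by rewrite /X (trmx_mul z^T) trmxK !mulmxA.
by rewrite mxE big_ord1 expr2 [X^T _ _]mxE.
Qed.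

Lemma M1pi_sym : (M1pi P w K ktf U p)^T = M1pi P w K ktf U p.
Proof.
have [Msym _] := posdef_inv posdef_Mp.
by rewrite /M1pi linearD linearZ /= !trmx_mul !trmxK Msym mulmxA.
Qed.

Lemma M1pi_ge0 (z : 'cV[R]_q) : 0 <= (z^T *m M1pi P w K ktf U p *m z) 0 0.
Proof.
rewrite M1pi_quad addr_ge0 ?(mulr_ge0 ktf0 (sqr_ge0 _)) //.
by apply: posdef_ge0; apply: posdef_inv; exact: posdef_Mp.
Qed.

Lemma multiplier_estimate (C K0 eta : R) (pi pi' : 'cV[R]_q) :
  M1pi P w K ktf U p \in unitmx -> `|invmx (M1pi P w K ktf U p)| <= C ->
  r1p P w U p + Gam1p P w U p *m pi = 0 -> transversality P w pi ->
  (forall t, t \in `[t0 P, tf w] -> `|K t| <= K0) ->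
  (forall t, t \in `[t0 P, tf w] -> `|stationarity_gap pi' t| <= eta) ->
  `|hf P w + (pi'^T *m gdot P w) 0 0| <= eta ->
  `|pi - pi'| ^+ 2 <=
    q%:R ^+ 2 * C * (m%:R ^+ 2 * K0 * (tf w - t0 P) + ktf) * eta ^+ 2.
Proof.
move=> uM hC hr htr hK0 hgap htau.
have eta0 : 0 <= eta by apply: le_trans htau.
have C0 : 0 <= C by apply: le_trans hC.
apply: le_trans (semidefinite_coercive _ M1pi_sym uM hC M1pi_ge0) _.
rewrite -[leRHS]mulrA ler_wpM2l ?mulr_ge0 ?sqr_ge0 // M1pi_quad mulrDl.
have -> : Gam1p P w U p *m (pi - pi') = - (r1p P w U p + Gam1p P w U p *m pi').
  rewrite mulmxBr opprD; congr (_ - _); apply/eqP.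
  by rewrite -addr_eq0 addrC hr.
rewrite r1p_Gam1p; set r := mxint _ _ _.
have -> : (- r)^T *m invmx (Mp P w K U p) *m (- r) =
    r^T *m invmx (Mp P w K U p) *m r.
  by rewrite [(- r)^T]linearN /= mulmxN !mulNmx opprK.
apply: lerD.
  have [_ _ cup freeU] := hU.
  have cgap := sub (@within_stationarity_gap pi').
  apply: le_trans (bessel t0f cK hK cup freeU cgap) _.
  have c1 : {within `[t0 P, tf w], continuous (fun t =>
      ((stationarity_gap pi' t)^T *m K t *m stationarity_gap pi' t) 0 0)}.
    have /within_mxP : {within `[t0 P, tf w], continuous (fun t =>
      ((stationarity_gap pi' t)^T *m K t *m stationarity_gap pi' t))}; last exact.
    move=> x; apply: cvg_mulmx; last exact: cgap.
    by apply: cvg_mulmx; [apply: cvg_trmx; exact: cgap|exact: cK].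
  apply: le_trans (ler_norm _) _.
  rewrite (_ : _ * _ * _ * _ =
    m%:R ^+ 2 * K0 * eta ^+ 2 * `|tf w - t0 P|); last first.
    by rewrite ger0_norm ?subr_ge0 ?ltW //; ring.
  apply: (oint_norm_le t0f c1) => // t tab; apply: le_trans (quad_le _ _) _.
  apply: ler_pM; rewrite ?mulr_ge0 ?sqr_ge0 //.
    by rewrite ler_wpM2l ?sqr_ge0 // hK0.
  by rewrite lerXn2r ?nnegrE // hgap.
rewrite ler_wpM2l //.
have -> : ((pi - pi')^T *m gdot P w) 0 0 = - (hf P w + (pi'^T *m gdot P w) 0 0).
  rewrite linearB /= mulmxBl !mxE.
  by move: htr; rewrite /transversality mxE => /eqP; rewrite addr_eq0 => /eqP ->; ring.
rewrite sqrrN -real_normK ?num_real // lerXn2r ?nnegrE //.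
Qed.

End Multiplier.

(** * Uniform convergence *)

Section UniformConvergence.
Context {R : realType}.

Definition ucvg (I : Type) (V : normedModType R) (D : nat -> set I)
    (y : nat -> I -> V) (z : I -> V) :=
  forall e : R, 0 < e -> \forall k \near \oo, forall i, D k i -> `|y k i - z i| <= e.

Definition ubounded (I : Type) (V : normedModType R) (D : nat -> set I)
    (z : I -> V) :=
  exists2 M : R, 0 <= M & \forall k \near \oo, forall i, D k i -> `|z i| <= M.

Lemma ucvg_linear (I : Type) (V : normedModType R) (D : nat -> set I)
    (y : nat -> I -> V) (z : I -> V) C : 0 <= C ->
  (forall e : R, 0 < e ->
    \forall k \near \oo, forall i, D k i -> `|y k i - z i| <= C * e) ->
  ucvg D y z.
Proof.
move=> C0 h e e0; have c0 : 0 < C + 1 by rewrite ltr_wpDl.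
have e0' : 0 < e / (C + 1) by rewrite divr_gt0.
apply: filterS (h _ e0') => k hk i Di; apply: le_trans (hk i Di) _.
rewrite mulrA ler_pdivrMr // mulrC ler_pM2l //.
by rewrite lerDl.
Qed.

Lemma ucvg_reindex (I J : Type) (V : normedModType R) (D : nat -> set I)
    (D' : nat -> set J) (u : J -> I) (y : nat -> I -> V) (z : I -> V) :
  (forall k j, D' k j -> D k (u j)) ->
  ucvg D y z -> ucvg D' (fun k j => y k (u j)) (fun j => z (u j)).
Proof.
by move=> Du h e /h; apply: filterS => k hk j /Du; exact: hk.
Qed.

Lemma ucvg_cst (I : Type) (V : normedModType R) (D : nat -> set I)
    (a : nat -> V) (l : V) : a @ \oo --> l -> ucvg D (fun k _ => a k) (fun=> l).
Proof.
move=> /cvgrPdist_le h e /h; apply: filterS => k hk i _.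
by rewrite distrC.
Qed.

Lemma ucvgD (I : Type) (V : normedModType R) (D : nat -> set I)
    (y y' : nat -> I -> V) (z z' : I -> V) : ucvg D y z -> ucvg D y' z' ->
  ucvg D (fun k i => y k i + y' k i) (fun i => z i + z' i).
Proof.
move=> h h'; apply: (@ucvg_linear _ _ _ _ _ 2) => // e e0.
apply: filterS2 (h e e0) (h' e e0) => k hk hk' i Di.
rewrite opprD addrACA; apply: le_trans (ler_normD _ _) _.
by rewrite mulr_natl mulr2n lerD ?hk ?hk'.
Qed.

Lemma ucvg_mx (I : Type) d e (D : nat -> set I) (y : nat -> I -> 'M[R]_(d, e))
    (z : I -> 'M[R]_(d, e)) :
  (forall i j, ucvg D (fun k t => y k t i j) (fun t => z t i j)) -> ucvg D y z.
Proof.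
move=> h eps eps0.
have H : \forall k \near \oo, forall ij : 'I_d * 'I_e, forall t, D k t ->
    `|y k t ij.1 ij.2 - z t ij.1 ij.2| <= eps.
  by apply: filter_forall => ij; exact: h.
apply: filterS H => k hk t Dt; apply: mxnorm_le => [|i j]; first exact: ltW.
by rewrite !mxE; exact: (hk (i, j)).
Qed.

Lemma ucvg_tr (I : Type) d e (D : nat -> set I) (y : nat -> I -> 'M[R]_(d, e))
    (z : I -> 'M[R]_(d, e)) :
  ucvg D y z -> ucvg D (fun k i => (y k i)^T) (fun i => (z i)^T).
Proof.
move=> h eps /h; apply: filterS => k hk i Di.
by rewrite -linearB /= mxnorm_tr hk.
Qed.

Lemma ucvg_mulmx (I : Type) d e c (D : nat -> set I)
    (y : nat -> I -> 'M[R]_(d, e)) (z : I -> 'M[R]_(d, e))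
    (y' : nat -> I -> 'M[R]_(e, c)) (z' : I -> 'M[R]_(e, c)) :
  ubounded D z -> ubounded D z' -> ucvg D y z -> ucvg D y' z' ->
  ucvg D (fun k i => y k i *m y' k i) (fun i => z i *m z' i).
Proof.
move=> [M M0 bz] [M' M'0 bz'] h h'.
apply: (@ucvg_linear _ _ _ _ _ (e%:R * (M' + 1) + e%:R * M)).
  by rewrite addr_ge0 ?mulr_ge0 ?addr_ge0.
move=> eps eps0; near=> k => i Di.
have -> : y k i *m y' k i - z i *m z' i =
    (y k i - z i) *m y' k i + z i *m (y' k i - z' i).
  by rewrite mulmxBl mulmxBr addrA subrK.
apply: le_trans (ler_normD _ _) _; rewrite mulrDl; apply: lerD.
  apply: le_trans (mxnorm_mul _ _) _; rewrite -!mulrA ler_wpM2l // mulrC.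
  apply: ler_pM => //.
    rewrite -(subrK (z' i) (y' k i)); apply: le_trans (ler_normD _ _) _.
    rewrite addrC; apply: lerD; move: i Di; near: k => //.
    exact: h'.
  by move: i Di; near: k; exact: h.
apply: le_trans (mxnorm_mul _ _) _; rewrite -!mulrA ler_wpM2l //.
by apply: ler_pM => //; move: i Di; near: k => //; exact: h'.
Unshelve. all: by end_near. Qed.

Lemma compact_near_continuous (U V : normedModType R) (Z : set U) (F : U -> V) :
  compact Z -> continuous F -> forall e : R, 0 < e ->
  \forall d \near (0 : R)^'+, forall z, Z z -> forall y, `|y - z| <= d ->
    `|F y - F z| <= e.
Proof.
move=> /compact_near_coveringP cZ cF e e0.
apply: cZ => z Zz.
have e20 : 0 < e / 2 by rewrite divr_gt0.
have /cvgrPdist_le/(_ _ e20) := cF z.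
move=> /nbhs_ballP[r /= r0 hr].
have r20 : 0 < r / 2 by rewrite divr_gt0.
exists (ball z (r / 2), [set d | 0 < d < r / 2]) => /=.
  split; first exact: nbhsx_ballx.
  by apply: filterS2 (nbhs_right_gt 0) (nbhs_right_lt r20) => d d0 dr; apply/andP.
move=> [x d] /= [zx /andP[d0 dr]] y yx.
have hx : `|F z - F x| <= e / 2.
  by apply: hr; apply: le_ball zx; rewrite ler_pdivrMr // ler_pMr // ler1n.
have hy : `|F z - F y| <= e / 2.
  apply: hr; rewrite -ball_normE /=.
  rewrite -(subrK x z) -addrA; apply: le_lt_trans (ler_normD _ _) _.
  rewrite (splitr r); apply: ltrD; last by rewrite distrC (le_lt_trans yx).
  by move: zx; rewrite -ball_normE.
rewrite -(subrK (F z) (F y)) -addrA; apply: le_trans (ler_normD _ _) _.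
by rewrite (splitr e) lerD // distrC.
Qed.

Lemma ucvg_comp (I : Type) (U V : normedModType R) (D : nat -> set I)
    (y : nat -> I -> U) (z : I -> U) (Z : set U) (F : U -> V) :
  compact Z -> continuous F -> (\forall k \near \oo, forall i, D k i -> Z (z i)) ->
  ucvg D y z -> ucvg D (fun k i => F (y k i)) (fun i => F (z i)).
Proof.
move=> cZ cF hZ h e e0.
have := compact_near_continuous cZ cF e0.
move=> /(filterI (nbhs_right_gt 0)) /filter_ex[d [d0 hd]].
apply: filterS2 hZ (h d d0) => k Zk hk i Di.
by apply: hd; [exact: Zk|exact: hk].
Qed.

Lemma ucvg_eval (I : Type) (V : normedModType R) (D : nat -> set I)
    (y : nat -> I -> V) (z : I -> V) (u : nat -> I) (l : V) :
  ucvg D y z -> (\forall k \near \oo, D k (u k)) ->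
  (fun k => z (u k)) @ \oo --> l -> (fun k => y k (u k)) @ \oo --> l.
Proof.
move=> h Du /cvgrPdist_le hz; apply/cvgrPdist_le => e e0.
have e20 : 0 < e / 2 by rewrite divr_gt0.
apply: filterS3 Du (hz _ e20) (h _ e20) => k Dk hk hk'.
rewrite -(subrK (z (u k)) l) -addrA; apply: le_trans (ler_normD _ _) _.
by rewrite (splitr e) lerD // distrC hk'.
Qed.

Lemma cvg_within_seq (V : topologicalType) (A B : R) (y : R -> V) (u : nat -> R) x :
  {within `[A, B], continuous y} -> x \in `[A, B] ->
  (\forall k \near \oo, u k \in `[A, B]) -> u @ \oo --> x ->
  (fun k => y (u k)) @ \oo --> y x.
Proof.
move=> /subspace_continuousP cy xAB uAB ux W /(cy x xAB) hW.
have : \forall k \near \oo, u k \in `[A, B] -> W (y (u k)) by exact: ux hW.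
by apply: filterS2 uAB => k uk; exact.
Qed.

Lemma supdist_ucvg d a (b : nat -> R) (y : nat -> R -> 'cV[R]_d) (z : R -> 'cV[R]_d) :
  supdist a (b k) (y k) z @[k --> \oo] --> 0%E ->
  ucvg (fun k => [set` `[a, b k]]) y z.
Proof.
move=> h e e0; have e0' : (0%E < e%:E)%E by rewrite lte_fin.
have : \forall k \near \oo, (supdist a (b k) (y k) z < e%:E)%E.
  exact: h (nbhs_open_ereal_lt e0').
apply: filterS => k hk t tab; apply: le_trans (mxnorm_enorm _) _.
rewrite -lee_fin; apply: le_trans (ltW hk).
by apply: ereal_sup_ubound; exists t.
Qed.

Lemma ucvg_supdist d a (b : nat -> R) (y : nat -> R -> 'cV[R]_d) (z : R -> 'cV[R]_d) :
  (forall k, a <= b k) -> ucvg (fun k => [set` `[a, b k]]) y z ->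
  supdist a (b k) (y k) z @[k --> \oo] --> 0%E.
Proof.
move=> ab h.
have ge0 k : (0 <= supdist a (b k) (y k) z)%E.
  apply: (@le_trans _ _ (enorm (y k a - z a))%:E); first by rewrite lee_fin sqrtr_ge0.
  by apply: ereal_sup_ubound; exists a => //=; rewrite in_itv /= lexx ab.
have le e : 0 < e -> \forall k \near \oo, (supdist a (b k) (y k) z <= e%:E)%E.
  move=> e0; have c0 : 0 < d%:R + 1 :> R by rewrite ltr_wpDl.
  have e0' : 0 < e / (d%:R + 1) by rewrite divr_gt0.
  apply: filterS (h _ e0') => k hk; apply: ge_ereal_sup => _ [t tab <-].
  rewrite lee_fin; apply: le_trans (enorm_mxnorm _) _.
  apply: le_trans (ler_wpM2l _ (hk t tab)) _ => //.
  by rewrite mulrA ler_pdivrMr // mulrC ler_pM2l // lerDl.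
have fin k e : (supdist a (b k) (y k) z <= e%:E)%E ->
    supdist a (b k) (y k) z = (fine (supdist a (b k) (y k) z))%:E.
  move=> hk; rewrite fineK // fin_numElt (lt_le_trans _ (ge0 k)) ?ltNyr //=.
  by rewrite (le_lt_trans hk) // ltry.
apply/fine_cvgP; split.
  by apply: filterS (le 1 ltr01) => k /fin ->.
apply/cvgrPdist_le => e e0; apply: filterS (le e e0) => k hk.
have := ge0 k; have := hk; rewrite (fin _ _ hk) /= !lee_fin => h1 h2.
by rewrite sub0r normrN ger0_norm.
Qed.

End UniformConvergence.

Lemma lipschitz_ex (R : realType) (V W : normedModType R) (F : V -> W) :
  lipschitz F -> exists2 L : R, 0 <= L & forall y z, `|F y - F z| <= L * `|y - z|.
Proof.
move=> [M [_ /(_ (Num.max 0 M + 1)) h]]; exists (Num.max 0 M + 1).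
  by rewrite addr_ge0 // le_max lexx.
move=> y z; have lt : M < Num.max 0 M + 1.
  by rewrite (@le_lt_trans _ _ (Num.max 0 M)) ?le_max ?lexx ?orbT // ltrDl.
exact: (h lt (y, z) (conj I I)).
Qed.

Lemma gronwall_const_le (R : realType) d e (c l l' : R) : 0 <= c -> l <= l' ->
  gronwall_const d e c l <= gronwall_const d e c l'.
Proof. by move=> c0 ll'; rewrite ler_expR ler_wpM2l // !mulr_ge0. Qed.

Section Convergence.
Context {R : realType} {n m q : nat}.
Variables (P : ocp R n m q) (hat : traj R n m) (til : nat -> traj R n m).
Variables (T : nat -> R) (Ts : R).
Hypotheses (hP : regular P) (t0hat : t0 P < tf hat).
Hypotheses (t0til : forall k, t0 P < tf (til k)).
Hypotheses (hatT : forall k, tf hat <= T k) (tilT : forall k, tf (til k) <= T k).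
Hypotheses (hatTs : tf hat <= Ts) (TTs : \forall k \near \oo, T k <= Ts).
Hypotheses (hat_cont : forall k, continued P hat (T k))
  (hat_conts : continued P hat Ts).
Hypothesis til_cont : forall k, continued P (til k) (T k).
Let D k := [set` `[t0 P, T k]].
Hypothesis cvg_ctl : ucvg D (fun k => ctl (til k)) (ctl hat).
Hypothesis cvg_tf : tf (til k) @[k --> \oo] --> tf hat.

Let t0T k : t0 P < T k. Proof. exact: lt_le_trans (hatT k). Qed.
Let t0Ts : t0 P < Ts. Proof. exact: lt_le_trans hatTs. Qed.
Let tfin : tf hat \in `[t0 P, Ts]. Proof. by rewrite in_itv /= hatTs ltW. Qed.
Let tfinT k : tf hat \in `[t0 P, T k]. Proof. by rewrite in_itv /= hatT ltW. Qed.
Let tilin k : tf (til k) \in `[t0 P, T k]. Proof. by rewrite in_itv /= tilT ltW. Qed.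
Let t0in k : t0 P \in `[t0 P, T k]. Proof. by rewrite in_itv /= lexx ltW. Qed.

Let DTs k t : T k <= Ts -> D k t -> t \in `[t0 P, Ts].
Proof. by rewrite /D /= !in_itv /= => kTs /andP[-> tk]; rewrite (le_trans tk). Qed.

Let ubD (V : normedModType R) (y : R -> V) :
  {within `[t0 P, Ts], continuous y} -> ubounded D y.
Proof.
move=> /within_bounded[M M0 hM]; exists M => //.
by apply: filterS TTs => k kTs t Dt; exact/hM/(DTs kTs).
Qed.

Lemma ucvg_st : ucvg D (fun k => st (til k)) (st hat).
Proof.
have [_ _ [_ [/lipschitz_ex[L L0 hL] _]] _] := hP.
apply: (@ucvg_linear _ _ _ _ _ _ (gronwall_const n 1 L (Ts - t0 P))).
  exact/ltW/gronwall_const_gt0.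
move=> e e0; apply: filterS2 TTs (cvg_ctl e0) => k kTs hk t Dt.
have dx := deriv_onB (deriv_on_st hP (til_cont k) (t0T k))
                     (deriv_on_st hP (hat_cont k) (t0T k)).
have x0 : st (til k) (t0 P) - st hat (t0 P) = 0.
  have [_ _ h _] := til_cont k; have [_ _ h' _] := hat_cont k.
  by rewrite h // h' // /mxint; apply/matrixP => i j;
    rewrite !mxE /oint lexx set_itv1 !Rintegral_set1 subrr.
apply: le_trans (gronwall dx L0 (ltW e0) (t0in k) x0 _ Dt) _.
  move=> r /subset_itv_oo_cc rT; apply: le_trans (hL _ _) _; rewrite ler_wpM2l //.
  rewrite /zt !prod_normE /= subrr normr0 ge_max; apply/andP; split; last first.
    by rewrite addr_ge0 // ltW.
  rewrite ge_max; apply/andP; split; first by rewrite lerDl ltW.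
  by apply: le_trans (hk r rT) _; rewrite lerDr.
by rewrite mulrC ler_wpM2r ?(ltW e0) // gronwall_const_le // lerB.
Qed.

Lemma ucvg_zt : ucvg D (fun k => zt (til k)) (zt hat).
Proof.
move=> e e0; apply: filterS2 (cvg_ctl e0) (ucvg_st e0) => k hu hx t Dt.
rewrite /zt !prod_normE /= subrr normr0 !ge_max hx ?hu //=.
exact: ltW.
Qed.

Let compact_zt : compact (zt hat @` `[t0 P, Ts]).
Proof.
apply: continuous_compact; last exact: segment_compact.
exact: within_zt.
Qed.

Lemma ucvg_along (V : normedModType R) (F : 'cV[R]_n * 'cV[R]_m * R -> V) :
  continuous F -> ucvg D (fun k t => F (zt (til k) t)) (fun t => F (zt hat t)).
Proof.
move=> cF; apply: (ucvg_comp compact_zt cF _ ucvg_zt).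
by apply: filterS TTs => k kTs t Dt; exists t => //; exact: DTs Dt.
Qed.

Lemma ucvg_fx : ucvg D (fun k => fx P (til k)) (fx P hat).
Proof.
apply: ucvg_mx => i j.
have c : continuous (fun z => 'D_(dirx j) (f P) z i 0).
  by apply: continuous_entry; exact: regular_fx.
move=> e e0; apply: filterS (ucvg_along c e0) => k hk t Dt.
by rewrite !mxE; exact: hk.
Qed.

Lemma ucvg_fu : ucvg D (fun k => fu P (til k)) (fu P hat).
Proof.
apply: ucvg_mx => i j.
have c : continuous (fun z => 'D_(diru j) (f P) z i 0).
  by apply: continuous_entry; exact: regular_fu.
move=> e e0; apply: filterS (ucvg_along c e0) => k hk t Dt.
by rewrite !mxE; exact: hk.
Qed.

Lemma ucvg_Lx : ucvg D (fun k => Lx P (til k)) (Lx P hat).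
Proof.
apply: ucvg_mx => i j e e0.
have c := @regular_Lx _ _ _ _ _ hP i.
apply: filterS (ucvg_along c e0) => k hk t Dt.
by rewrite !mxE; exact: hk.
Qed.

Lemma ucvg_Lu : ucvg D (fun k => Lu P (til k)) (Lu P hat).
Proof.
apply: ucvg_mx => i j e e0.
have c := @regular_Lu _ _ _ _ _ hP i.
apply: filterS (ucvg_along c e0) => k hk t Dt.
by rewrite !mxE; exact: hk.
Qed.

Let D2 k : set (R * R) := [set ts | D k ts.1 /\ D k ts.2].

Lemma ubounded_Phi : ubounded D2 (fun ts => Phi hat ts.1 ts.2).
Proof.
have [M M0 hM] := fx_bounded hP hat_conts.
exists (transition_bound (n := n) M (Ts - t0 P)).
  by apply: le_trans (transition_bound_ge1 _ _).
apply: filterS TTs => k kTs [t s] /= [Dt Ds].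
by apply: (transition_bounded (transition_Phi hat_conts) M0 hM); exact: DTs kTs _.
Qed.

Lemma ucvg_Phi :
  ucvg D2 (fun k ts => Phi (til k) ts.1 ts.2) (fun ts => Phi hat ts.1 ts.2).
Proof.
have [M M0 hM] := fx_bounded hP hat_conts.
have M10 : 0 <= M + 1 by rewrite addr_ge0.
set l := Ts - t0 P.
pose C := transition_bound (n := n) (M + 1) l * gronwall_const n n (n%:R * (M + 1 + 1)) l.
apply: (@ucvg_linear _ _ _ _ _ _ C).
  rewrite mulr_ge0 ?(ltW (gronwall_const_gt0 _ _ _ _)) //.
  by apply: le_trans (transition_bound_ge1 _ _).
move=> e e0; apply: filterS3 TTs (ucvg_fx e0) (ucvg_fx ltr01) => k kTs he h1.
move=> [t s] [/= Dt Ds].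
have hMk r : r \in `[t0 P, T k] -> `|fx P hat r| <= M + 1.
  by move=> rT; apply: (@le_trans _ _ M); [exact/hM/(DTs kTs)|rewrite lerDl].
have hMk' r : r \in `[t0 P, T k] -> `|fx P (til k) r| <= M + 1.
  move=> rT; rewrite -(subrK (fx P hat r) (fx P (til k) r)).
  apply: le_trans (ler_normD _ _) _; rewrite addrC lerD ?h1 //.
  exact/hM/(DTs kTs).
have := transition_diff (transition_Phi (hat_cont k)) (transition_Phi (til_cont k))
  M10 (ltW e0) hMk hMk' he Ds Dt.
move=> h; apply: le_trans h _; rewrite /C [leRHS]mulrC -mulrA ler_wpM2l ?(ltW e0) //.
have lk : T k - t0 P <= l by rewrite lerB.
apply: ler_pM.
- by apply: le_trans (transition_bound_ge1 _ _).
- exact/ltW/gronwall_const_gt0.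
- by rewrite lerD2l gronwall_const_le // mulr_ge0.
- by rewrite gronwall_const_le // mulr_ge0 // addr_ge0.
Qed.

Lemma near_tf_in : \forall k \near \oo, tf (til k) \in `[t0 P, Ts].
Proof. by apply: filterS TTs => k kTs; exact: DTs (tilin k). Qed.

Lemma ucvg_Phi_tf :
  ucvg D (fun k t => Phi (til k) (tf (til k)) t) (fun t => Phi hat (tf hat) t).
Proof.
have [M M0 hM] := fx_bounded hP hat_conts.
set C := n%:R * M * transition_bound (n := n) M (Ts - t0 P).
have C0 : 0 <= C.
  by rewrite !mulr_ge0 // (le_trans _ (transition_bound_ge1 _ _)).
apply: (@ucvg_linear _ _ _ _ _ _ (1 + C)); first by rewrite addr_ge0.
move=> e e0; have /cvgrPdist_le/(_ _ e0) htf := cvg_tf.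
near=> k => t Dt.
have kTs : T k <= Ts by near: k.
rewrite -(subrK (Phi hat (tf (til k)) t) (Phi (til k) (tf (til k)) t)) -addrA.
apply: le_trans (ler_normD _ _) _; rewrite mulrDl mul1r; apply: lerD.
  have H : forall ts, D2 k ts -> `|Phi (til k) ts.1 ts.2 - Phi hat ts.1 ts.2| <= e.
    by near: k; exact: ucvg_Phi.
  by apply: (H (tf (til k), t)); split; first exact: tilin.
apply: le_trans (transition_lip (transition_Phi hat_conts) M0 hM _ _ _) _ => //.
- exact: DTs Dt.
- exact: DTs (tilin k).
rewrite ler_wpM2l // distrC; near: k; exact: htf.
Unshelve. all: by end_near. Qed.

Lemma cvg_zf : zf (til k) @[k --> \oo] --> zf hat.
Proof.
apply: cvg_pair_nbhs; last exact: cvg_tf.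
apply: (ucvg_eval (u := fun k => tf (til k)) ucvg_st).
  by apply: nearW => k; exact: tilin.
have [_ cx _ _] := hat_conts.
exact: cvg_within_seq cx tfin near_tf_in cvg_tf.
Qed.

Lemma cvg_along_zf (V : topologicalType) (F : 'cV[R]_n * R -> V) :
  continuous F -> F (zf (til k)) @[k --> \oo] --> F (zf hat).
Proof.
by move=> cF; apply: (cvg_app (y := fun k => zf (til k)));
  [exact: cvg_zf|exact: cF].
Qed.

Lemma cvg_along_tf (V : normedModType R) (F : 'cV[R]_n * 'cV[R]_m * R -> V) :
  continuous F ->
  F (zt (til k) (tf (til k))) @[k --> \oo] --> F (zt hat (tf hat)).
Proof.
move=> cF; apply: (ucvg_eval (u := fun k => tf (til k)) (ucvg_along cF)).
  by apply: nearW => k; exact: tilin.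
apply: (cvg_within_seq (y := fun t => F (zt hat t)) _ tfin near_tf_in cvg_tf).
exact: within_along.
Qed.

Lemma cvg_phix : phix P (til k) @[k --> \oo] --> phix P hat.
Proof.
apply/cvg_mxP => j i; rewrite mxE.
rewrite (_ : (fun _ => _) = fun k => 'D_(dirxf j) (phi P) (zf (til k))).
  apply: (cvg_along_zf (F := 'D_(dirxf j) (phi P))); have [_ [[_ h] _] _ _] := hP.
  by apply: (h _ _).2; left; exists j.
by apply/funext => k; rewrite mxE.
Qed.

Lemma cvg_phit : phit P (til k) @[k --> \oo] --> phit P hat.
Proof.
apply: (cvg_along_zf (F := 'D_dirtf (phi P))); have [_ [[_ h] _] _ _] := hP.
by apply: (h _ _).2; right.
Qed.

Lemma cvg_gx : gx P (til k) @[k --> \oo] --> gx P hat.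
Proof.
apply/cvg_mxP => i j; rewrite mxE.
rewrite (_ : (fun _ => _) = fun k => 'D_(dirxf j) (g P) (zf (til k)) i 0).
  have [_ _ _ [_ h]] := hP; have c : continuous ('D_(dirxf j) (g P)).
    by apply: (h _ _).2; left; exists j.
  by have /cvg_mxP := cvg_along_zf c; exact.
by apply/funext => k; rewrite mxE.
Qed.

Lemma cvg_gt : gt P (til k) @[k --> \oo] --> gt P hat.
Proof.
apply: (cvg_along_zf (F := 'D_dirtf (g P))); have [_ _ _ [_ h]] := hP.
by apply: (h _ _).2; right.
Qed.

Lemma cvg_gdot : gdot P (til k) @[k --> \oo] --> gdot P hat.
Proof.
apply: cvgD; last exact: cvg_gt.
apply: cvg_mulmx; first exact: cvg_gx.
by apply: (cvg_along_tf (F := f P)); have [_ _ [[]]] := hP.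
Qed.

Lemma cvg_hf : hf P (til k) @[k --> \oo] --> hf P hat.
Proof.
apply: cvgD; last by apply: (cvg_along_tf (F := Lag P)); have [[]] := hP.
apply: cvgD; first exact: cvg_phit.
have : (phix P (til k))^T *m f P (zt (til k) (tf (til k))) @[k --> \oo]
    --> (phix P hat)^T *m f P (zt hat (tf hat)).
  apply: cvg_mulmx; first by apply: cvg_trmx; exact: cvg_phix.
  by apply: (cvg_along_tf (F := f P)); have [_ _ [[]]] := hP.
by move=> /cvg_mxP; exact.
Qed.

Lemma ucvg_mxint : ucvg D
  (fun k t => mxint t (tf (til k)) (fun s => (Phi (til k) s t)^T *m Lx P (til k) s))
  (fun t => mxint t (tf hat) (fun s => (Phi hat s t)^T *m Lx P hat s)).
Proof.
have [ML ML0 hML] := within_bounded (within_Lx hP hat_conts).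
have [M M0 hM] := fx_bounded hP hat_conts.
set B := transition_bound (n := n) M (Ts - t0 P).
have B0 : 0 <= B by apply: le_trans (transition_bound_ge1 _ _).
set C := n%:R * B * ML.
have C0 : 0 <= C by rewrite !mulr_ge0.
apply: (@ucvg_linear _ _ _ _ _ _ ((Ts - t0 P) + C)).
  by rewrite addr_ge0 // subr_ge0 ltW.
move=> e e0; have /cvgrPdist_le/(_ _ e0) htf := cvg_tf.
have hdiff : ucvg D2 (fun k ts => (Phi (til k) ts.1 ts.2)^T *m Lx P (til k) ts.1)
    (fun ts => (Phi hat ts.1 ts.2)^T *m Lx P hat ts.1).
  apply: ucvg_mulmx; [| |exact: ucvg_tr ucvg_Phi|].
  - have [M' M'0 h] := ubounded_Phi; exists M' => //.
    by apply: filterS h => k hk ts Dts; rewrite mxnorm_tr; exact: hk.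
  - exists ML => //; apply: filterS TTs => k kTs [t s] [/= Dt Ds].
    exact/hML/(DTs kTs).
  - by apply: (ucvg_reindex _ ucvg_Lx) => k ts [].
near=> k => t Dt.
have kTs : T k <= Ts by near: k.
have htT : t \in `[t0 P, Ts] by exact: DTs Dt.
have cint w (hw : continued P w (T k)) :
    {within `[t0 P, T k], continuous (fun s => (Phi w s t)^T *m Lx P w s)}.
  move=> x; apply: cvg_mulmx; last exact: within_Lx.
  by apply: cvg_trmx; exact: within_Phi1.
have ck := cint _ (til_cont k); have ch := cint _ (hat_cont k).
rewrite [X in _ - X](_ : _ =
    mxint t (tf (til k)) (fun s => (Phi hat s t)^T *m Lx P hat s) +
    mxint (tf (til k)) (tf hat) (fun s => (Phi hat s t)^T *m Lx P hat s)); last first.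
  exact: (mxint_chasles (t0T k) ch).
rewrite opprD addrA -(mxintB ck ch) //.
apply: le_trans (ler_normB _ _) _; rewrite mulrDl; apply: lerD.
  apply: (@le_trans _ _ (e * `|tf (til k) - t|)).
    apply: (mxint_norm_le (t0T k) (ltW e0)) => //.
      by move=> x; apply: cvgB; [exact: ck|exact: ch].
    have H : forall ts, D2 k ts -> `|(Phi (til k) ts.1 ts.2)^T *m Lx P (til k) ts.1
        - (Phi hat ts.1 ts.2)^T *m Lx P hat ts.1| <= e.
      by near: k; exact: hdiff.
    by move=> s Ds; exact: (H (s, t)).
  rewrite mulrC ler_wpM2r ?(ltW e0) //.
  have := tilin k; move: htT Dt kTs; rewrite /D /= !in_itv /=.
  move=> /andP[h1 h2] /andP[h3 h4] h5 /andP[h6 h7].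
  by rewrite ler_norml; apply/andP; split; lra.
apply: (@le_trans _ _ (C * `|tf hat - tf (til k)|)).
  apply: (mxint_norm_le (t0T k) C0) => //.
  move=> s Ds; apply: le_trans (mxnorm_mul _ _) _; rewrite mxnorm_tr.
  have sTs := DTs kTs Ds.
  apply: ler_pM; rewrite ?mulr_ge0 //; last exact: hML.
  by rewrite ler_wpM2l // (transition_bounded (transition_Phi hat_conts) M0 hM).
by rewrite ler_wpM2l //; near: k; exact: htf.
Unshelve. all: by end_near. Qed.

Lemma ubounded_Phi_tf : ubounded D (fun t => (Phi hat (tf hat) t)^T).
Proof.
apply: ubD => x; apply: cvg_trmx; exact: (within_Phi2 hP hat_conts).
Qed.

Lemma ucvg_costate (pitil : nat -> 'cV[R]_q) (pihat : 'cV[R]_q) :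
  pitil @ \oo --> pihat ->
  ucvg D (fun k => costate P (til k) (pitil k)) (costate P hat pihat).
Proof.
move=> cpi; apply: ucvgD; last exact: ucvg_mxint.
apply: ucvg_mulmx.
- exact: ubounded_Phi_tf.
- by exists `|phix P hat + (gx P hat)^T *m pihat| => //; exact: nearW.
- exact: ucvg_tr ucvg_Phi_tf.
apply: ucvg_cst; apply: cvgD; first exact: cvg_phix.
by apply: cvg_mulmx => //; apply: cvg_trmx; exact: cvg_gx.
Qed.

Lemma ucvg_stationarity_gap (pi : 'cV[R]_q) :
  ucvg D (fun k => stationarity_gap P (til k) pi) (stationarity_gap P hat pi).
Proof.
apply: ucvgD; first exact: ucvg_Lu.
apply: ucvg_mulmx.
- by apply: ubD => x; apply: cvg_trmx; exact: (within_fu hP hat_conts).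
- by apply: ubD; exact: within_costate.
- exact: ucvg_tr ucvg_fu.
by apply: ucvg_costate; exact: cvg_cst.
Qed.

(* The gap of the limit vanishes on [t0, tf hat], and the part of [t0, tf (til k)]
   past [tf hat] shrinks to [tf hat]. *)
Lemma near_stationarity_gap (pi : 'cV[R]_q) :
  (forall t, t \in `[t0 P, tf hat] -> stationarity_gap P hat pi t = 0) ->
  forall e : R, 0 < e -> \forall k \near \oo,
    forall t, t \in `[t0 P, tf (til k)] -> `|stationarity_gap P (til k) pi t| <= e.
Proof.
move=> gap0 e e0; have e20 : 0 < e / 2 by rewrite divr_gt0.
have := @within_stationarity_gap _ _ _ _ _ _ _ hP hat_conts t0hat hatTs pi.
move=> /subspace_continuousP/(_ _ tfin).
move=> /cvgrPdist_le/(_ _ e20); rewrite near_withinE.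
move=> /nbhs_ballP[r /= r0 hr].
have /cvgrPdist_lt/(_ _ r0) htf := cvg_tf.
apply: filterS3 TTs htf (ucvg_stationarity_gap pi e20) => k kTs hk hgap t tk.
have Dt : D k t.
  by move: tk; rewrite /D /= !in_itv /= => /andP[-> tk]; rewrite (le_trans tk).
rewrite -(subrK (stationarity_gap P hat pi t) (stationarity_gap P (til k) pi t)).
apply: le_trans (ler_normD _ _) _; rewrite (splitr e) lerD ?hgap //.
have [tt|tt] := leP t (tf hat).
  rewrite gap0 ?normr0 ?(ltW e20) // in_itv /= tt andbT.
  by move: tk; rewrite in_itv /= => /andP[].
have gapf : stationarity_gap P hat pi (tf hat) = 0.
  by apply: gap0; rewrite in_itv /= lexx ltW.
have : ball (tf hat) r t -> t \in `[t0 P, Ts] ->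
    `|stationarity_gap P hat pi (tf hat) - stationarity_gap P hat pi t| <= e / 2 := hr t.
rewrite gapf sub0r normrN.
apply; last exact: DTs Dt.
rewrite -ball_normE /=; apply: le_lt_trans hk.
move: tk; rewrite in_itv /= => /andP[_ tk].
rewrite !ltr0_norm ?subr_lt0 //; last exact: lt_le_trans tk.
by rewrite lerN2 lerB.
Qed.

Lemma cvg_multiplier (K : R -> 'M[R]_m) (ktf : R) (s : nat -> nat)
    (U : forall k, R -> 'cV[R]_(s k) -> 'cV[R]_m) (p : forall k, 'cV[R]_(s k))
    (pitil : nat -> 'cV[R]_q) (pihat : 'cV[R]_q) :
  {within `[t0 P, Ts], continuous K} ->
  (forall t, t \in `[t0 P, Ts] -> posdef (K t)) -> 0 <= ktf ->
  (forall k, parameterized P (til k) (U k) (p k)) ->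
  (forall k, r1p P (til k) (U k) (p k) + Gam1p P (til k) (U k) (p k) *m pitil k = 0) ->
  (forall k, transversality P (til k) (pitil k)) ->
  uniformly_invertible (fun k => M1pi P (til k) K ktf (U k) (p k)) ->
  (forall t, t \in `[t0 P, tf hat] -> stationarity_gap P hat pihat t = 0) ->
  transversality P hat pihat -> pitil @ \oo --> pihat.
Proof.
move=> cK hK ktf0 hU hr htr [C hC] gap0 htr0.
have [K0 K00 hK0] := within_bounded cK.
have C0 : 0 <= C by have [_] := hC 0; apply: le_trans.
set A := q%:R ^+ 2 * C * (m%:R ^+ 2 * K0 * (Ts - t0 P) + ktf).
have A0 : 0 <= A.
  by rewrite mulr_ge0 ?addr_ge0 ?mulr_ge0 ?sqr_ge0 // subr_ge0 ltW.
have cvg_tau : hf P (til k) + (pihat^T *m gdot P (til k)) 0 0 @[k --> \oo] --> 0.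
  have htr1 : hf P hat + (pihat^T *m gdot P hat) 0 0 = 0 := htr0.
  rewrite -[X in _ --> X]htr1; apply: cvgD; first exact: cvg_hf.
  have : pihat^T *m gdot P (til k) @[k --> \oo] --> pihat^T *m gdot P hat.
    by apply: cvg_mulmx; [exact: cvg_cst|exact: cvg_gdot].
  by move=> /cvg_mxP; exact.
apply/cvgrPdist_le => e e0.
have c0 : 0 < A + 1 by rewrite ltr_wpDl.
have e0' : 0 < e / (A + 1) by rewrite divr_gt0.
move: cvg_tau => /cvgrPdist_le/(_ _ e0') htau.
apply: filterS3 TTs htau (near_stationarity_gap gap0 e0') => k kTs.
rewrite sub0r normrN => tauk gapk.
have inTs t : t \in `[t0 P, tf (til k)] -> t \in `[t0 P, Ts].
  rewrite !in_itv /= => /andP[-> tk] /=; apply: le_trans tk _.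
  exact: le_trans (tilT k) kTs.
have tfTs : tf (til k) <= Ts by apply: le_trans kTs.
have [uM iM] := hC k.
have := multiplier_estimate hP (til_cont k) (t0til k) (tilT k)
  (within_subsegment (lexx _) tfTs cK) (fun t tk => hK t (inTs t tk)) (hU k) ktf0
  uM iM (hr k) (htr k) (fun t tk => hK0 t (inTs t tk)) gapk tauk.
set x := `|_ - _|; set d := e / (A + 1) => h.
rewrite distrC -/x.
have h2 : x ^+ 2 <= A * d ^+ 2.
  apply: le_trans h _; rewrite ler_wpM2r ?sqr_ge0 // ler_wpM2l ?mulr_ge0 ?sqr_ge0 //.
  by rewrite lerD2r ler_wpM2l ?mulr_ge0 ?sqr_ge0 // lerB.
have x0 : 0 <= x by rewrite normr_ge0.
have h3 : x ^+ 2 <= ((A + 1) * d) ^+ 2.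
  apply: le_trans h2 _; rewrite [leRHS](exprMn 2 (A + 1)) ler_wpM2r ?sqr_ge0 //.
  by rewrite expr2; nra.
have -> : e = (A + 1) * d by rewrite /d mulrC divfK // gt_eqF.
by rewrite -(@ler_pXn2r _ 2) ?nnegrE // mulr_ge0 // ltW.
Qed.

End Convergence.

Lemma cvg_eventually_le (R : realType) (T : nat -> R) (l : R) :
  (forall k, l <= T k) -> T @ \oo --> l ->
  exists k0, \forall k \near \oo, T k <= T k0.
Proof.
move=> lT cT; have [[k0 hk0]|h] := pselect (exists k, l < T k).
  by exists k0; apply: filterS (cvgr_lt _ cT _ hk0) => k /ltW.
exists 0; apply: nearW => k; rewrite (le_trans _ (lT 0)) // leNgt.
by apply/negP => lk; apply: h; exists k.
Qed.

Theorem theorem4 (R : realType) (n m q : nat) (P : ocp R n m q)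
    (K : R -> 'M[R]_m) (ktf : R) (Kg : 'M[R]_q)
    (hat : traj R n m) (pihat : 'cV[R]_q)
    (til : nat -> traj R n m) (pitil : nat -> 'cV[R]_q)
    (s : nat -> nat) (U : forall k, R -> 'cV[R]_(s k) -> 'cV[R]_m)
    (p : forall k, 'cV[R]_(s k))
    (T : nat -> R) (hT : forall k, T k = Num.max (tf (til k)) (tf hat))
    (hP : regular P)
    (hK : forall k, {within `[t0 P, T k], continuous K} /\
                    forall t, t \in `[t0 P, T k] -> posdef (K t))
    (hktf : 0 < ktf) (hKg : posdef Kg)
    (hat_opt : optimal P hat)
    (hat_cond : optimality P hat K ktf Kg pihat)
    (hat_cont : forall k, continued P hat (T k))
    (til_feas : forall k, feasible P (til k))
    (til_par : forall k, parameterized P (til k) (U k) (p k))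
    (til_cond : forall k,
        approx_optimality P (til k) K ktf Kg (U k) (p k) (pitil k))
    (til_cont : forall k, continued P (til k) (T k))
    (til_nondeg :
       uniformly_invertible (fun k => M1pi P (til k) K ktf (U k) (p k)))
    (cvg_ctl :
       supdist (t0 P) (T k) (ctl (til k)) (ctl hat) @[k --> \oo] --> 0%E)
    (cvg_tf : tf (til k) @[k --> \oo] --> tf hat) :
  supdist (t0 P) (T k) (st (til k)) (st hat) @[k --> \oo] --> 0%E /\
  supdist (t0 P) (T k) (costate P (til k) (pitil k)) (costate P hat pihat)
    @[k --> \oo] --> 0%E.
Proof.
have hatT k : tf hat <= T k by rewrite hT le_max lexx orbT.
have tilT k : tf (til k) <= T k by rewrite hT le_max lexx.
have t0hat : t0 P < tf hat by have [[]] := hat_opt.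
have t0til k : t0 P < tf (til k) by have [] := til_feas k.
have t0T k : t0 P <= T k by rewrite (le_trans (ltW t0hat)).
have cT : T @ \oo --> tf hat.
  move/cvgrPdist_le: cvg_tf => h; apply/cvgrPdist_le => e e0.
  apply: filterS (h e e0) => k; rewrite hT.
  by have [_ _|//] := leP (tf (til k)) (tf hat); rewrite subrr normr0 ltW.
have [k0 TT] := cvg_eventually_le hatT cT.
have ucvg_ctl := supdist_ucvg cvg_ctl.
split; apply: ucvg_supdist => //.
  exact: (ucvg_st hP t0hat hatT TT hat_cont til_cont ucvg_ctl).
have [cK pK] := hK k0.
have [_ gap0 htr0 _ _] := hat_cond.
have gap0' t : t \in `[t0 P, tf hat] -> stationarity_gap P hat pihat t = 0.
  by move=> tt; rewrite /stationarity_gap -pu_costate gap0.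
apply: (ucvg_costate hP t0hat t0til hatT tilT (hatT k0) TT hat_cont (hat_cont k0)
  til_cont ucvg_ctl cvg_tf).
apply: (cvg_multiplier hP t0hat t0til hatT tilT (hatT k0) TT hat_cont (hat_cont k0)
  til_cont ucvg_ctl cvg_tf cK pK (ltW hktf) til_par _ _ til_nondeg gap0' htr0) => k;
  by have [] := til_cond k.
Qed.
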